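(* Assume the setting described in the context, where $(X_i,Y_i)_{i=1}^n$ is stationary $\beta$-mixing with coefficients $\beta(\cdot)$, and $\gamma>0$ and $\mathcal{A}$ are such that $\mathcal{A}$ is a family of Borel measurable subsets of $\mathcal{X}$ with finite VC dimension $d$ and $\mathbb{P}[X_*\in A]>\gamma$ for all $A\in\mathcal{A}$. Let $\alpha\in(0,1)$ and $\delta_{\mathrm{cal}}>0$, and define \[\varepsilon_{\mathrm{cal}}=\inf_{(a,m,r)\in G_{\mathrm{cal}}}\left\{\frac{1}{\gamma}\left(4\sqrt{\frac{\log(2(m+1)^d)}{m}}+\frac{2(r-1)}{n_{\mathrm{cal}}}+2\sqrt{\frac{1}{2m}\log\left(\frac{16}{\delta_{\mathrm{cal}}-16(m-1)\beta(a)-\beta(r)}\right)}\right)\right\},\] where $G_{\mathrm{cal}}=\{(a,m,r)\in\mathbb{N}_{>0}^3: 2ma=n_{\mathrm{cal}}-r+1,\ \delta_{\mathrm{cal}}>16(m-1)\beta(a)+\beta(r)\}$. Then for each $A\in\mathcal{A}$ and any $i\in I_{\mathrm{test}}$, with $\varepsilon_{\mathrm{test}}=\beta(i-n_{\mathrm{train}})$ and $\eta=\varepsilon_{\mathrm{cal}}+\delta_{\mathrm{cal}}+\varepsilon_{\mathrm{test}}$, \[\mathbb{P}[Y_i\in C_{1-\alpha}(X_i;A)\mid X_i\in A]\ge 1-\alpha-\eta.\] Additionally, if $\widehat{s}_{\mathrm{train}}(X_*,Y_* )$ almost surely has a continuous distribution conditionally on the training data, then \[\left|\mathbb{P}[Y_i\in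 C_{1-\alpha}(X_i;A)\mid X_i\in A]-(1-\alpha)\right|\le\varepsilon_{\mathrm{cal}}+\delta_{\mathrm{cal}}+\varepsilon_{\mathrm{test}}.\]
   Context: Let $\mathcal{X},\mathcal{Y}$ be measurable spaces. A stochastic process $\{Z_t\}_{t\in\mathbb{Z}}$ is stationary if its finite-dimensional distributions are shift-invariant; its $\beta$-mixing coefficient at $a\in\mathbb{N}$ is $\beta(a)=\|\mathbb{P}_{-\infty:0,a:\infty}-\mathbb{P}_{-\infty:0}\otimes\mathbb{P}_{a:\infty}\|_{\mathrm{TV}}$ (total variation distance between the joint law of the blocks $(Z_{-\infty:0},Z_{a:\infty})$ and the product of their laws), and the process is $\beta$-mixing if $\beta(a)\to0$. ''The sample $(X_i,Y_i)_{i=1}^n$ is stationary $\beta$-mixing'' means $(X_i,Y_i)=Z_i$, $i=1,\dots,n$, for such a process with values in $\mathcal{X}\times\mathcal{Y}$. Let $(X_*,Y_* )$ be independent of the sample with $(X_*,Y_* )\sim(X_1,Y_1)$. Write $n=n_{\mathrm{train}}+n_{\mathrm{cal}}+n_{\mathrm{test}}$ with positive integers, $I_{\mathrm{train}}=\{1,\dots,n_{\mathrm{train}}\}$, $I_{\mathrm{cal}}=\{n_{\mathrm{train}}+1,\dots,n_{\mathrm{train}}+n_{\mathrm{cal}}\}$, $I_{\mathrm{test}}=\{n_{\mathrm{train}}+n_{\mathrm{cal}}+1,\dots,n\}$. Let $s:(\mathcal{X}\times\mathcal{Y})^{n_{\mathrm{train}}+1}\to\mathbb{R}$ be any (measurable)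 function and $\widehat{s}_{\mathrm{train}}(x,y)=s((X_i,Y_i)_{i\in I_{\mathrm{train}}},(x,y))$. For $A\in\mathcal{A}$: $I_{\mathrm{cal}}(A)=\{i\in I_{\mathrm{cal}}:X_i\in A\}$, $n_{\mathrm{cal}}(A)=\#I_{\mathrm{cal}}(A)$; for $\phi\in[0,1)$, $\widehat{q}_{\phi,\mathrm{cal}}(A)=\inf\{t\in\mathbb{R}:\frac{1}{n_{\mathrm{cal}}(A)}\sum_{i\in I_{\mathrm{cal}}(A)}\mathbf{1}\{\widehat{s}_{\mathrm{train}}(X_i,Y_i)\le t\}\ge\phi\}$, and for $x\in A$ (when $n_{\mathrm{cal}}(A)>0$) $C_\phi(x;A)=\{y\in\mathcal{Y}:\widehat{s}_{\mathrm{train}}(x,y)\le\widehat{q}_{\phi,\mathrm{cal}}(A)\}$. An infimum over the empty set is $+\infty$. *)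

(* Defs.v *)
From HB Require Import structures.
From mathcomp Require Import all_boot all_order all_algebra.
From mathcomp Require Import all_classical all_reals all_analysis.
Set Implicit Arguments. Unset Strict Implicit. Unset Printing Implicit Defensive.
Import Order.TTheory GRing.Theory Num.Theory.
Import numFieldNormedType.Exports.
Local Open Scope classical_set_scope.
Local Open Scope ring_scope.

Section Defs.
Context {R : realType} {d : measure_display} {Omega : measurableType d}
  {dX dY : measure_display} {TX : measurableType dX} {TY : measurableType dY}.
Variable P : probability Omega R.
Variable Z : int -> Omega -> (TX * TY)%type.

Definition process_measurable : Prop :=
  forall t : int, measurable_fun [set: Omega] (Z t).

Definition stationary : Prop :=
  forall (k : nat) (ts : k.-tuple int) (h : int)
         (B : set (k.-tuple (TX * TY)%type)),
    measurable B ->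
    P [set w | B (map_tuple (fun t => Z t w) ts)] =
    P [set w | B (map_tuple (fun t => Z (t + h) w) ts)].

Definition sigma_block (S : set int) : set (set Omega) :=
  <<s [set E | exists t, S t /\ exists B, measurable B /\ E = Z t @^-1` B] >>.

Definition prod_sigma (F1 F2 : set (set Omega)) : set (set (Omega * Omega)) :=
  <<s [set E | exists E1 E2, F1 E1 /\ F2 E2 /\ E = E1 `*` E2] >>.

(* beta(a) = TV distance between the joint law of (Z_{-oo:0}, Z_{a:oo}) and
   the product of the two marginal laws.  Pulled back to Omega x Omega with
   the sigma-algebra sigma(Z_{-oo:0}) (x) sigma(Z_{a:oo}): the joint law is
   E |-> P{w | (w,w) in E}, the product law is
   E |-> \int P{w' | (w,w') in E} dP(w); TV = sup_E |joint E - product E|. *)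
Definition beta_coef (a : nat) : R :=
  fine (ereal_sup
    [set `| P [set w | E (w, w)] - \int[P]_w P [set w' | E (w, w')] |%E
     | E in prod_sigma (sigma_block [set t | t <= 0])
                       (sigma_block [set t | (a%:Z <= t)])]).

Definition beta_mixing : Prop := beta_coef @ \oo --> (0 : R).

End Defs.

Section VC.
Context {dX : measure_display} {TX : measurableType dX}.

Definition shatters (cA : set (set TX)) (F : seq TX) : Prop :=
  uniq F /\
  forall B : seq TX, {subset B <= F} ->
    exists2 A, cA A & forall x, x \in F -> (A x <-> x \in B).

Definition VC_dim (cA : set (set TX)) (dd : nat) : Prop :=
  (exists F, shatters cA F /\ size F = dd) /\
  (forall F, shatters cA F -> (size F <= dd)%N).
End VC.

Section Conformal.
Context {R : realType} {d : measure_display} {Omega : measurableType d}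
  {dX dY : measure_display} {TX : measurableType dX} {TY : measurableType dY}.
Variable Z : int -> Omega -> (TX * TY)%type.
Variables ntr ncal : nat.
Variable s : (ntr.+1).-tuple (TX * TY)%type -> R.

Definition s_hat (w : Omega) (x : TX) (y : TY) : R :=
  s (mktuple (fun j : 'I_ntr.+1 =>
       if (j < ntr)%N then Z (Posz j.+1) w else (x, y))).

Definition I_cal : seq nat := iota ntr.+1 ncal.

Definition n_calA (A : set TX) (w : Omega) : nat :=
  count (fun i : nat => `[< A (Z (Posz i) w).1 >]) I_cal.

Definition emp_cdf (A : set TX) (w : Omega) (t : R) : R :=
  (count (fun i : nat => `[< A (Z (Posz i) w).1 >] &&
            (s_hat w (Z (Posz i) w).1 (Z (Posz i) w).2 <= t)) I_cal)%:R
  / (n_calA A w)%:R.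

(* \hat q_{phi,cal}(A) (in extended reals; inf of empty set = +oo);
   convention: +oo when n_cal(A) = 0 (C_phi is then all of Y). *)
Definition q_hat (phi : R) (A : set TX) (w : Omega) : \bar R :=
  if n_calA A w == 0%N then +oo%E
  else ereal_inf [set t%:E | t in [set t : R | phi <= emp_cdf A w t]].

Definition in_C (phi : R) (A : set TX) (w : Omega) (x : TX) (y : TY) : Prop :=
  ((s_hat w x y)%:E <= q_hat phi A w)%E.

End Conformal.

Definition cond_prob {R : realType} {d : measure_display}
  {Omega : measurableType d} (P : probability Omega R) (E F : set Omega) : R :=
  fine (P (E `&` F)) / fine (P F).

Definition eps_cal_term {R : realType} (beta : nat -> R) (gamma delta : R)
  (dd ncal a m r : nat) : R :=
  gamma^-1 *
   (4 * Num.sqrt (ln (2 * (m.+1)%:R ^+ dd) / m%:R)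
    + 2 * (r%:R - 1) / ncal%:R
    + 2 * Num.sqrt ((2 * m%:R)^-1 *
          ln (16 / (delta - 16 * (m%:R - 1) * beta a - beta r)))).

Definition G_cal {R : realType} (beta : nat -> R) (delta : R) (ncal : nat)
  (a m r : nat) : Prop :=
  [/\ (0 < a)%N, (0 < m)%N, (0 < r)%N,
      (2 * m * a + r = ncal + 1)%N &
      16 * (m%:R - 1) * beta a + beta r < delta].

Definition eps_cal {R : realType} (beta : nat -> R) (gamma delta : R)
  (dd ncal : nat) : \bar R :=
  ereal_inf [set (eps_cal_term beta gamma delta dd ncal
                   amr.1.1 amr.1.2 amr.2)%:E
            | amr in [set amr : nat * nat * nat |
                       G_cal beta delta ncal amr.1.1 amr.1.2 amr.2]].

(* Main.v *)
Require Import Defs.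
From HB Require Import structures.
From mathcomp Require Import all_boot all_order all_algebra.
From mathcomp Require Import all_classical all_reals all_analysis.
From mathcomp Require Import measurable_realfun ring lra zify.
Import Order.TTheory GRing.Theory Num.Theory.
Import numFieldNormedType.Exports.
Local Open Scope classical_set_scope.
Local Open Scope ring_scope.

(** Since [A] is fixed, neither a uniform bound over the family nor a blocking
    argument is needed.  Drop the last [a - 1] calibration points, so that the
    test point lies at distance at least [a] from what is left; decoupling it
    costs [beta a] and leaves the expected [nu]-mass, [nu] being the law of
    [Z_1], of the points of [A] rejected by the calibration set.  Rejection of
    [z] means that the count of calibration scores below that of [z] exceeds its
    target.  At a fixed level of the conditional rank given the training data
    the centred count is a sum of bounded terms with conditional mean zero, and
    two terms at distance at least [a] have covariance at most [2 * beta a]; so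
    the variance of the empirical mean is at most [2 a / n + 2 beta a].
    Chebyshev's inequality at the levels [k * sg] below the target, summed over
    [k] (the sum of [1 / k^2] converges), bounds the expected rejected mass by
    its target plus [O(sqrt (1 / m))].  The term [eps_cal] exceeds this error:
    the term is at least [1] unless [m > 16], and then [16 (m - 1) beta a < delta]
    makes [beta a] negligible against [1 / sqrt m].  The upper bound follows by
    applying the same estimate to the negated score with [alpha] in place of
    [1 - alpha]; continuity of the score distribution removes the ties. *)

(** * Means of bounded measurable functions *)

Section BoundedMeasurable.
Context {R : realType} {d : measure_display} {T : measurableType d}.
Implicit Types f g : T -> R.

(** A class closed under sums, products, measurable substitution and partial integration, whose
    members are integrable for every probability. *)
Definition bmf f : Prop :=
  measurable_fun [set: T] f /\ exists M : R, forall x, `|f x| <= M.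

Lemma bmf_cst (c : R) : bmf (fun=> c).
Proof. by split; [exact: measurable_cst | exists `|c|]. Qed.

Lemma bmfD f g : bmf f -> bmf g -> bmf (fun x => f x + g x).
Proof.
move=> [mf [M fM]] [mg [N gN]]; split; first exact: measurable_funD.
by exists (M + N) => x; rewrite (le_trans (ler_normD _ _))// lerD.
Qed.

Lemma bmfM f g : bmf f -> bmf g -> bmf (fun x => f x * g x).
Proof.
move=> [mf [M fM]] [mg [N gN]]; split; first exact: measurable_funM.
by exists (M * N) => x; rewrite normrM ler_pM.
Qed.

Lemma bmfN f : bmf f -> bmf (fun x => - f x).
Proof.
move=> [mf [M fM]]; split; first exact: measurable_funN.
by exists M => x; rewrite normrN.
Qed.

Lemma bmfB f g : bmf f -> bmf g -> bmf (fun x => f x - g x).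
Proof. by move=> bf bg; apply: bmfD => //; exact: bmfN. Qed.

Lemma bmf_sum (I : Type) (r : seq I) (h : I -> T -> R) :
  (forall i, bmf (h i)) -> bmf (fun x => \sum_(i <- r) h i x).
Proof.
move=> bh; elim: r => [|i r IH].
  by under eq_fun do rewrite big_nil; exact: bmf_cst.
by under eq_fun do rewrite big_cons; exact: bmfD.
Qed.

Lemma bmf_bool (b : T -> bool) :
  measurable_fun [set: T] b -> bmf (fun x => (b x)%:R).
Proof.
move=> mb; split; last by exists 1 => x; case: (b x); rewrite ?normr0 ?normr1.
rewrite (_ : (fun x => _) = fun x => if b x then 1 else 0); last first.
  by apply/funext => x; case: (b x).
by apply: measurable_fun_ifT => //; exact: measurable_cst.
Qed.

Lemma measurable_mem (A : set T) :
  measurable A -> measurable_fun [set: T] (fun x => x \in A).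
Proof.
move=> mA; apply: (measurable_fun_bool true); rewrite setTI.
rewrite [X in measurable X](_ : _ = A)//.
by apply/seteqP; split=> x /=; [exact: set_mem | exact: mem_set].
Qed.

End BoundedMeasurable.

Lemma bmf_comp {R : realType} {d1 d2 : measure_display}
  {T1 : measurableType d1} {T2 : measurableType d2}
  (f : T2 -> R) (g : T1 -> T2) :
  bmf f -> measurable_fun [set: T1] g -> bmf (fun x => f (g x)).
Proof.
move=> [mf [M fM]] mg; split; last by exists M.
exact: (@measurableT_comp _ _ _ _ _ _ f _ g).
Qed.

Section Mean.
Context {R : realType} {d : measure_display} {T : measurableType d}.
Variable P : probability T R.
Implicit Types f g : T -> R.

Definition mean f : R := \int[P]_x f x.

Lemma bmf_integrable f : bmf f -> P.-integrable [set: T] (EFin \o f).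
Proof.
move=> [mf [M fM]]; apply: measurable_bounded_integrable => //.
  by rewrite (le_lt_trans (probability_le1 _ _))// ltry.
exists M; split; first exact: num_real.
by move=> x Mx y _ /=; rewrite (le_trans (fM y))// ltW.
Qed.

Lemma mean_cst c : mean (fun=> c) = c.
Proof. by rewrite /mean Rintegral_cst//= probability_setT mulr1. Qed.

Lemma meanD f g : bmf f -> bmf g -> mean (fun x => f x + g x) = mean f + mean g.
Proof. by move=> bf bg; rewrite /mean RintegralD//; exact: bmf_integrable. Qed.

Lemma meanB f g : bmf f -> bmf g -> mean (fun x => f x - g x) = mean f - mean g.
Proof. by move=> bf bg; rewrite /mean RintegralB//; exact: bmf_integrable. Qed.

Lemma meanZ (c : R) f : bmf f -> mean (fun x => c * f x) = c * mean f.
Proof. by move=> bf; rewrite /mean RintegralZl//; exact: bmf_integrable. Qed.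

Lemma le_mean f g : bmf f -> bmf g -> (forall x, f x <= g x) -> mean f <= mean g.
Proof.
by move=> bf bg fg; rewrite /mean le_Rintegral//; exact: bmf_integrable.
Qed.

Lemma mean_sum (I : Type) (r : seq I) (h : I -> T -> R) :
  (forall i, bmf (h i)) ->
  mean (fun x => \sum_(i <- r) h i x) = \sum_(i <- r) mean (h i).
Proof.
move=> bh; elim: r => [|i r IH].
  by under eq_fun do rewrite big_nil; rewrite big_nil mean_cst.
under eq_fun do rewrite big_cons.
by rewrite big_cons meanD ?IH//; exact: bmf_sum.
Qed.

Lemma eq_ae_mean f g : bmf f -> bmf g -> {ae P, forall x, f x = g x} ->
  mean f = mean g.
Proof.
move=> bf bg fg; rewrite /mean /Rintegral; congr fine.
apply: ae_eq_integral => //; [exact/measurable_EFinP/bf.1|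
  exact/measurable_EFinP/bg.1|].
by apply: filterS fg => x /= -> _.
Qed.

Lemma mean_bool (b : T -> bool) : measurable_fun [set: T] b ->
  mean (fun x => (b x)%:R) = fine (P [set x | b x]).
Proof.
move=> mb; have mB : measurable [set x | b x].
  by rewrite -[X in measurable X]setTI; exact: (mb measurableT [set true]).
rewrite /mean /Rintegral -(setIT [set x | b x]) -integral_indic//.
congr fine; apply: eq_integral => x _; rewrite indicE.
by rewrite (_ : (x \in _) = b x)//; apply/idP/idP => [/set_mem|bx]; last exact: mem_set.
Qed.

Lemma EFin_mean f : bmf f -> (mean f)%:E = (\int[P]_x (f x)%:E)%E.
Proof. by move=> bf; rewrite /mean /Rintegral fineK//; exact/integrable_fin_num/bmf_integrable. Qed.

Lemma mean_ge0 f : (forall x, 0 <= f x) -> 0 <= mean f.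
Proof. by move=> f0; exact: Rintegral_ge0. Qed.

Lemma mean_le1 f : bmf f -> (forall x, f x <= 1) -> mean f <= 1.
Proof. by move=> bf f1; rewrite -[leRHS]mean_cst; apply: le_mean => //; exact: bmf_cst. Qed.

End Mean.

Lemma bmf_mean {R : realType} {d1 d2 : measure_display}
  {T1 : measurableType d1} {T2 : measurableType d2} (Q : probability T2 R)
  (f : T1 * T2 -> R) :
  bmf f -> bmf (fun x => mean Q (fun y => f (x, y))).
Proof.
move=> bf; have bs x : bmf (fun y => f (x, y)).
  exact: (bmf_comp f (pair x) bf (pair1_measurable _)).
have [mf [M fM]] := bf; split; last first.
  exists M => x; rewrite ler_norml; apply/andP; split.
    rewrite -(mean_cst Q (- M)); apply: le_mean => //; first exact: bmf_cst.
    by move=> y; have := fM (x, y); rewrite ler_norml => /andP[].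
  rewrite -[leRHS](mean_cst Q M); apply: le_mean => //; first exact: bmf_cst.
  by move=> y; have := fM (x, y); rewrite ler_norml => /andP[].
(* Adding the bound [M] makes the integrand nonnegative, as Tonelli's measurability theorem
   requires. *)
rewrite (_ : (fun x => _) =
    fun x => fine (\int[Q]_y ((f (x, y) + M)%:E))%E - M); last first.
  apply/funext => x; rewrite -/(Rintegral _ _ _) -/(mean _ _) meanD//.
    by rewrite mean_cst addrK.
  exact: bmf_cst.
apply: measurable_funB; last exact: measurable_cst.
apply: (@measurableT_comp _ _ _ _ _ _ fine) => //.
apply: (@measurable_fun_fubini_tonelli_F _ _ _ _ _ Q (fun z => (f z + M)%:E)).
  by apply/measurable_EFinP; apply: measurable_funD => //; exact: measurable_cst.
by move=> z; rewrite lee_fin -lerBlDr sub0r; have := fM z; rewrite ler_norml => /andP[].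
Qed.

(** * Total variation *)

(** The sum counts the positive integers up to [x], so it is the floor of [x]. *)
Lemma sum_geq_nat (R : realType) (x : R) (N : nat) : 0 <= x -> x <= N%:R ->
  \sum_(j < N) (j.+1%:R <= x)%R%:R <= x <= 1 + \sum_(j < N) (j.+1%:R <= x)%R%:R.
Proof.
move=> x0; elim: N => [|N IH] xN.
  by rewrite !big_ord0 x0 addr0 (le_trans xN)//= ler01.
rewrite !big_ord_recr/=; have [Nx|xN1] := leP N.+1%:R x.
  rewrite (eq_bigr (fun=> 1)) => [|j _]; last first.
    by rewrite (le_trans _ Nx)// ler_nat ltnS ltnW.
  rewrite sumr_const card_ord (natr1 N : N%:R + true%:R = N.+1%:R :> R).
  apply/andP; split=> //.
  by rewrite (le_trans xN)// lerDr ler01.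
rewrite addr0; have [xN'|Nx] := leP x N%:R; first exact: IH.
rewrite (eq_bigr (fun=> 1)) => [|j _]; last first.
  by rewrite (le_trans _ (ltW Nx))// ler_nat.
by rewrite sumr_const card_ord nat1r (ltW Nx) (ltW xN1).
Qed.

Section TotalVariation.
Context {R : realType} {d d1 d2 : measure_display} {Omega : measurableType d}
  {T1 : measurableType d1} {T2 : measurableType d2}.
Variables (P : probability Omega R) (nu : probability T2 R).
Variables (X : Omega -> T1) (Y : Omega -> T2) (b : R).
Hypotheses (mX : measurable_fun [set: Omega] X)
  (mY : measurable_fun [set: Omega] Y).
Hypothesis decoupled_set : forall c : T1 * T2 -> bool,
  measurable_fun [set: T1 * T2] c ->
  mean P (fun w => (c (X w, Y w))%:R) <=
  mean P (fun w => mean nu (fun y => (c (X w, y))%:R)) + b.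

Let bmfXY (f : T1 * T2 -> R) : bmf f -> bmf (fun w => f (X w, Y w)).
Proof.
by move=> bf; apply: (bmf_comp f (fun w => (X w, Y w)) bf); exact: measurable_fun_pair.
Qed.

Let bmfX (f : T1 * T2 -> R) : bmf f -> bmf (fun w => mean nu (fun y => f (X w, y))).
Proof.
move=> bf.
exact: (bmf_comp (fun x => mean nu (fun y => f (x, y))) X (bmf_mean nu f bf)).
Qed.

Let bmfx (f : T1 * T2 -> R) x : bmf f -> bmf (fun y => f (x, y)).
Proof. by move=> bf; exact: (bmf_comp f (pair x) bf (pair1_measurable _)). Qed.

(* Layer cake: N f lies within 1 of the number of j < N with j + 1 <= N f. *)
Lemma decoupled_unit (f : T1 * T2 -> R) : bmf f -> (forall z, 0 <= f z <= 1) ->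
  mean P (fun w => f (X w, Y w)) <=
  mean P (fun w => mean nu (fun y => f (X w, y))) + b.
Proof.
move=> bf f01; pose L1 g := mean P (fun w => g (X w, Y w)).
pose L2 g := mean P (fun w => mean nu (fun y => g (X w, y))).
rewrite -/(L1 f) -/(L2 f).
(* The total rounding error is at most [1] for every [N], so a positive value of [L1 f - L2 f - b]
   is refuted by a large [N]. *)
suff N_le (N : nat) : N%:R * (L1 f - L2 f - b) <= 1.
  rewrite -subr_le0 opprD addrA leNgt; apply/negP => h0.
  have := N_le (Num.Def.truncn (L1 f - L2 f - b)^-1).+1.
  apply/negP; rewrite -ltNge -ltr_pdivrMr// mul1r.
  by rewrite truncnS_gt.
pose c (j : nat) z := j.+1%:R <= N%:R * f z.
have mc j : measurable_fun [set: T1 * T2] (c j).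
  apply: measurable_fun_ler; first exact: measurable_cst.
  by apply: measurable_funM; [exact: measurable_cst|exact: bf.1].
have bc j : bmf (fun z => (c j z)%:R : R) by exact: bmf_bool.
have count z : \sum_(j < N) (c j z)%:R <= N%:R * f z <=
    1 + \sum_(j < N) (c j z)%:R.
  have /andP[f0 f1] := f01 z.
  by apply: sum_geq_nat; [rewrite mulr_ge0|rewrite ler_piMr].
have bNf : bmf (fun z => N%:R * f z) by apply: bmfM => //; exact: bmf_cst.
have bsum : bmf (fun z => \sum_(j < N) (c j z)%:R : R).
  by apply: bmf_sum => j; exact: bc.
have L1f : N%:R * L1 f <= 1 + \sum_(j < N) L1 (fun z => (c j z)%:R).
  rewrite /L1 -meanZ; last exact: bmfXY.
  rewrite -mean_sum; last by move=> j; exact: (bmfXY (fun z => (c j z)%:R)).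
  rewrite -[X in _ <= X + _](mean_cst P 1) -meanD; last 2 first.
  - exact: bmf_cst.
  - exact: (bmfXY (fun z => \sum_(j < N) (c j z)%:R)).
  apply: le_mean => [||w]; last by have /andP[] := count (X w, Y w).
  - exact: (bmfXY (fun z => N%:R * f z)).
  - by apply: bmfD; [exact: bmf_cst|exact: (bmfXY (fun z => \sum_(j < N) (c j z)%:R))].
have L2f : \sum_(j < N) L2 (fun z => (c j z)%:R) <= N%:R * L2 f.
  rewrite /L2 -meanZ; last exact: bmfX.
  rewrite -mean_sum; last by move=> j; exact: (bmfX (fun z => (c j z)%:R)).
  apply: le_mean => [||w].
  - by apply: bmf_sum => j; exact: (bmfX (fun z => (c j z)%:R)).
  - by apply: bmfM; [exact: bmf_cst|exact: bmfX].
  rewrite -mean_sum; last by move=> j; exact: (bmfx (fun z => (c j z)%:R)).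
  rewrite -meanZ; last exact: bmfx.
  apply: le_mean => [||y]; last by have /andP[] := count (X w, y).
  - exact: (bmfx (fun z => \sum_(j < N) (c j z)%:R)).
  - exact: (bmfx (fun z => N%:R * f z)).
have : \sum_(j < N) L1 (fun z => (c j z)%:R) <=
    \sum_(j < N) (L2 (fun z => (c j z)%:R) + b).
  by apply: ler_sum => j _; exact: decoupled_set.
rewrite big_split/= sumr_const card_ord -[b *+ N]mulr_natl => Lc.
by rewrite !mulrBr; lra.
Qed.

(** The affine map [(1 + f) / 2] carries values in [-1, 1] to [0, 1]; undoing it doubles the error
    [b]. *)
Lemma decoupled_sym (f : T1 * T2 -> R) : bmf f -> (forall z, `|f z| <= 1) ->
  mean P (fun w => f (X w, Y w)) <=
  mean P (fun w => mean nu (fun y => f (X w, y))) + 2 * b.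
Proof.
move=> bf f1; pose h z := 2^-1 + 2^-1 * f z.
have bh : bmf h by apply: bmfD; [|apply: bmfM => //]; exact: bmf_cst.
have /(decoupled_unit _ bh) : forall z, 0 <= h z <= 1.
  by move=> z; have := f1 z; rewrite ler_norml /h => /andP[? ?]; apply/andP; split; lra.
rewrite /h meanD; [|exact: bmf_cst|]; last first.
  by apply: bmfM; [exact: bmf_cst|exact: bmfXY].
rewrite meanZ; last exact: bmfXY.
rewrite (_ : (fun w => mean nu _) =
    fun w => 2^-1 + 2^-1 * mean nu (fun y => f (X w, y))); last first.
  apply/funext => w; rewrite meanD; [|exact: bmf_cst|].
    by rewrite meanZ ?mean_cst//; exact: bmfx.
  by apply: bmfM; [exact: bmf_cst|exact: bmfx].
rewrite meanD; [|exact: bmf_cst|]; last first.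
  by apply: bmfM; [exact: bmf_cst|exact: bmfX].
rewrite meanZ; last exact: bmfX.
by rewrite !mean_cst; lra.
Qed.

End TotalVariation.

(** * Ranks *)

(** Serves to exhaust a set of scores whose supremum is not attained. The sequence is
    [sup B - 1 / (n + 1)] if [B] is bounded above and [n] otherwise; its terms need not lie in
    [B]. *)
Lemma cofinal_sequence (R : realType) (B : set R) :
  B !=set0 -> (forall x, B x -> exists2 y, B y & x < y) ->
  exists c : nat -> R, [/\ {homo c : m n / (m <= n)%N >-> m <= n},
    forall n, exists2 y, B y & c n <= y & forall x, B x -> exists n, x <= c n].
Proof.
move=> B0 Bnomax; have [ubB|nubB] := pselect (has_ubound B).
  have supB : has_sup B by [].
  exists (fun n => sup B - n.+1%:R^-1); split.
  - by move=> m n mn; rewrite lerB// lef_pV2 ?posrE ?ltr0n// ler_nat.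
  - move=> n; have [|y By /ltW ?] := @sup_adherent _ B n.+1%:R^-1 _ supB.
      by rewrite invr_gt0.
    by exists y.
  - move=> x Bx; have [y By xy] := Bnomax _ Bx.
    have xs : 0 < sup B - x.
      by rewrite subr_gt0 (lt_le_trans xy)//; exact: ub_le_sup.
    exists (Num.Def.truncn (sup B - x)^-1).
    rewrite lerBrDr -lerBrDl invf_ple ?posrE//.
    by rewrite ltW// truncnS_gt.
exists (fun n => n%:R); split.
- by move=> m n mn; rewrite ler_nat.
- move=> n; apply: contrapT => ny; apply: nubB; exists n%:R => y By.
  by rewrite leNgt; apply/negP => /ltW ny'; apply: ny; exists y.
- move=> x _; exists (Num.Def.truncn x).+1.
  by rewrite ltW// truncnS_gt.
Qed.

Lemma mean_nondecreasing_le {R : realType} {d : measure_display}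
    {T : measurableType d} (P : probability T R)
    (e : nat -> T -> bool) (b : T -> bool) (u : R) :
  (forall n, measurable_fun [set: T] (e n)) -> measurable_fun [set: T] b ->
  (forall m n x, (m <= n)%N -> e m x -> e n x) ->
  (forall x, b x -> exists n, e n x) ->
  (forall n, mean P (fun x => (e n x)%:R) <= u) ->
  mean P (fun x => (b x)%:R) <= u.
Proof.
have mset (c : T -> bool) : measurable_fun [set: T] c -> measurable [set x | c x].
  by move=> mc; rewrite -[X in measurable X]setTI; exact: (mc measurableT [set true]).
move=> me mb e_nd be eu; rewrite mean_bool//.
have finP A : measurable A -> P A \is a fin_num by move=> mA; exact: fin_num_measure.
rewrite -lee_fin fineK; last exact/finP/mset.
have mU : measurable (\bigcup_n [set x | e n x]).
  by apply: bigcup_measurable => n _; exact: mset.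
have PU : (P (\bigcup_n [set x | e n x]) <= u%:E)%E.
  have cvP := @nondecreasing_cvg_mu _ _ _ P (fun n => [set x | e n x]).
  apply: (cvge_to_le (cvP _ mU _)); first by move=> n; exact: mset.
    by move=> m n mn; apply/subsetPset => x; exact: e_nd.
  apply: nearW => n /=; have := eu n; rewrite mean_bool// -lee_fin fineK//.
  exact/finP/mset.
apply: le_trans PU; apply: le_measure; rewrite ?inE//; first exact: mset.
by move=> x /be [n en]; exists n.
Qed.

Section Rank.
Context {R : realType} {d : measure_display} {S : measurableType d}.
Variables (nu : probability S R) (a : S -> bool) (g : S -> R).
Hypotheses (ma : measurable_fun [set: S] a) (mg : measurable_fun [set: S] g).

(** The distribution function of [g] under the restriction of [nu] to [a], taken at the point's own
    value. It is not normalised by the mass of [a]. *)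
Definition rank (z : S) : R := mean nu (fun y => (a y && (g y <= g z))%:R).

Let mle (c : R) : measurable_fun [set: S] (fun y => a y && (g y <= c)).
Proof. by apply: measurable_and => //; apply: measurable_fun_ler => //; exact: measurable_cst. Qed.

Hypothesis mrank : measurable_fun [set: S] rank.

(** Within [a] the event [rank z < u] is a lower set for [g], and its part below the level [g z] of
    one of its points has mass [rank z < u]. If [g] has a maximum on the event, one such part is
    everything; otherwise countably many levels exhaust it. *)
Lemma rank_superuniform (u : R) : 0 <= u ->
  mean nu (fun z => (a z && (rank z < u))%:R) <= u.
Proof.
move=> u0; have mb : measurable_fun [set: S] (fun z => a z && (rank z < u)).
  by apply: measurable_and => //; apply: measurable_fun_ltr => //; exact: measurable_cst.
pose B := [set g z | z in [set z | a z && (rank z < u)]].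
have [[x [z0 z0S gz0] xmax]|nomax] := pselect (exists2 x, B x & forall y, B y -> y <= x).
  have /andP[_ /ltW rz0] := z0S; apply: le_trans rz0.
  apply: le_mean; [exact: bmf_bool|exact/bmf_bool/mle|move=> z].
  case: (boolP (a z && (rank z < u))) => [zS|_]; last by rewrite ler0n.
  have /andP[-> _] := zS; rewrite gz0 (_ : g z <= x)//.
  by apply: xmax; exists z.
have [B0|/set0P B0] := eqVneq B set0.
  rewrite (_ : (fun z => _) = fun=> 0) ?mean_cst//; apply/funext => z.
  case: (boolP (a z && (rank z < u))) => // zS.
  suff : B (g z) by rewrite B0.
  by exists z.
have [x Bx|c [c_nd c_B B_c]] := cofinal_sequence _ B B0.
  apply: contrapT => nxy; apply: nomax; exists x => // y By.
  by rewrite leNgt; apply/negP => xy; apply: nxy; exists y.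
apply: (@mean_nondecreasing_le _ _ _ _ (fun n z => a z && (g z <= c n))) => //.
- by move=> m n z mn /andP[-> gz]; rewrite (le_trans gz) ?c_nd.
- move=> z zS; have [|n gz] := B_c (g z); first by exists z.
  by exists n; have /andP[-> _] := zS.
- move=> n; have [_ [z zS <-] cz] := c_B n.
  have /andP[_ /ltW rz] := zS; apply: le_trans rz.
  apply: le_mean; [exact/bmf_bool/mle|exact/bmf_bool/mle|move=> y].
  case: (a y) => //=; rewrite ler_nat; case: (leP (g y) (c n)) => //= gy.
  by rewrite (le_trans gy).
Qed.

End Rank.

(** * Calibration risk *)

(** The first [k] at which [b] fails is at most the number of indices at which [b] holds; if [b]
    never fails, that number is [K]. *)
Lemma first_failure_le (R : realType) (b : nat -> bool) (x0 sg y : R) (K : nat) :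
  0 <= sg -> (forall k, (k < K)%N -> ~~ b k -> y <= x0 + sg * k%:R) ->
  y <= x0 + sg * K%:R -> y <= x0 + sg * \sum_(k < K) (b k)%:R.
Proof.
move=> sg0 yk yK.
have [//|all_b] : y <= x0 + sg * \sum_(k < K) (b k)%:R \/
    \sum_(k < K) (b k)%:R = K%:R :> R; last by rewrite all_b.
elim: K yk {yK} => [|K IH] yk; first by right; rewrite big_ord0.
have [k kK|yle|sumK] := IH; first by apply: yk; rewrite ltnS ltnW.
  left; rewrite big_ord_recr/= (le_trans yle)// lerD2l ler_wpM2l// lerDl.
  exact: ler0n.
rewrite big_ord_recr/= sumK; case: (boolP (b K)) => bK; first by right; rewrite natr1.
by left; rewrite addr0; exact: yk.
Qed.

Lemma sum_inv_sqr_le2 (R : realType) (K : nat) :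
  \sum_(k < K) (k.+1%:R ^- 2) <= 2 :> R.
Proof.
(* The term [- 1 / (m + 1)] strengthens the claim so that the induction telescopes. *)
suff H m : \sum_(k < m.+1) (k.+1%:R ^- 2) <= 2 - m.+1%:R^-1 :> R.
  case: K => [|m]; first by rewrite big_ord0.
  by rewrite (le_trans (H m))// gerBl invr_ge0.
elim: m => [|m IH]; first by rewrite big_ord1 expr1n invr1; lra.
rewrite big_ord_recr/=; apply: (@le_trans _ _ (2 - m.+1%:R^-1 + m.+2%:R ^- 2)).
  by rewrite lerD2r.
suff : m.+2%:R ^- 2 <= m.+1%:R^-1 - m.+2%:R^-1 :> R.
  by move: (m.+2%:R ^- 2) (m.+1%:R^-1) (m.+2%:R^-1) => p q r; lra.
rewrite -[m.+2]addn1 natrD; set x : R := m.+1%:R.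
have x0 : 0 < x by rewrite ltr0n.
have -> : x^-1 - (x + 1)^-1 = (x * (x + 1))^-1 by field; apply/andP; split; lra.
by rewrite lef_pV2 ?posrE//; nra.
Qed.

Lemma window_count (n lo m : nat) :
  (\sum_(l < n) ((lo <= l) && (l < lo + m)) <= m)%N.
Proof.
suff : (\sum_(l < n) ((lo <= l) && (l < lo + m)) <= minn m (n - lo))%N by lia.
elim: n => [|n IH]; first by rewrite big_ord0.
rewrite big_ord_recr/=; move: (\sum_(_ < n) _)%N IH => t IH.
by case: (leqP lo n) => ?; case: (ltnP n (lo + m)) => ? /=; lia.
Qed.

Section SecondMoment.
Context {R : realType} {d : measure_display} {Omega : measurableType d}.
Variables (P : probability Omega R) (psi : nat -> Omega -> R) (n a : nat) (b : R).
Hypotheses (bpsi : forall j, bmf (psi j)) (psi1 : forall j w, `|psi j w| <= 1).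
Hypothesis b0 : 0 <= b.
Hypothesis psi_cov : forall j l, (j < n)%N -> (l < n)%N -> (j + a <= l)%N ->
  mean P (fun w => psi j w * psi l w) <= b.

(** In each row of the expanded square at most [2 * a] indices lie closer than [a] to [j], each
    contributing at most [1]; every other index contributes at most [b]. *)
Lemma second_moment_le :
  mean P (fun w => (\sum_(j < n) psi j w) ^+ 2) <= 2 * a%:R * n%:R + b * n%:R ^+ 2.
Proof.
have bprod j l : bmf (fun w => psi j w * psi l w) by exact: bmfM.
rewrite (_ : (fun w => _) = fun w => \sum_(j < n) \sum_(l < n) psi j w * psi l w);
  last first.
  by apply/funext => w; rewrite expr2 mulr_suml; under eq_bigr do rewrite mulr_sumr.
rewrite mean_sum; last by move=> j; apply: bmf_sum => l; exact: bprod.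
have row (j : 'I_n) : mean P (fun w => \sum_(l < n) psi j w * psi l w) <=
    2 * a%:R + b * n%:R.
  rewrite mean_sum; last by move=> l; exact: bprod.
  (* The window contains every [l] at distance less than [a] from [j]. If [j < a], the truncated
     [j - a] is [0] and the window still ends beyond [j + a]. *)
  apply: (@le_trans _ _ (\sum_(l < n) (((j - a <= l)%N && (l < j - a + 2 * a)%N)%:R + b))).
    apply: ler_sum => l _.
    have [/andP[jl lj]|] := boolP ((j - a <= l) && (l < j - a + 2 * a))%N.
      apply: (@le_trans _ _ 1); last by rewrite lerDl.
      apply: mean_le1 => // w; rewrite (le_trans (ler_norm _))// normrM.
      by rewrite mulr_ile1.
    move=> far; rewrite add0r; have [jl|lj] := leqP (j + a) l; first exact: psi_cov.
    under eq_fun do rewrite mulrC.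
    by apply: psi_cov => //; lia.
  rewrite big_split/= sumr_const card_ord -[b *+ n]mulr_natr lerD2r -natr_sum -natrM ler_nat.
  exact: window_count.
apply: (le_trans (ler_sum _ (fun j _ => row j))).
by rewrite sumr_const card_ord -[leLHS]mulr_natr; lra.
Qed.

End SecondMoment.

(** Chebyshev's inequality, from the pointwise bound of the indicator of [e] by [M ^ 2 / x ^ 2]. *)
Lemma mean_bool_le_sqr {R : realType} {d : measure_display} {T : measurableType d}
    (P : probability T R) (e : T -> bool) (M : T -> R) (x V : R) :
  measurable_fun [set: T] e -> bmf M -> 0 < x ->
  (forall w, e w -> x <= M w) -> mean P (fun w => M w ^+ 2) <= V ->
  mean P (fun w => (e w)%:R) <= V / x ^+ 2.
Proof.
move=> me bM x0 eM MV; have bM2 : bmf (fun w => M w ^+ 2).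
  by under eq_fun do rewrite expr2; exact: bmfM.
rewrite mulrC (@le_trans _ _ (x ^- 2 * mean P (fun w => M w ^+ 2)))//; last first.
  by rewrite ler_wpM2l// invr_ge0 exprn_ge0// ltW.
rewrite -meanZ//; apply: le_mean => [||w]; first exact: bmf_bool.
  by apply: bmfM => //; exact: bmf_cst.
rewrite mulrC; case: (boolP (e w)) => [/eM xM|_].
  by rewrite ler_pdivlMr ?exprn_gt0// mul1r lerXn2r// nnegrE ?ltW// (lt_le_trans x0).
by rewrite mulr_ge0 ?sqr_ge0// invr_ge0 sqr_ge0.
Qed.

(** * Expected mass rejected by a weakly dependent calibration set *)

Section CalibrationRisk.
Context {R : realType} {d d1 d2 : measure_display} {Omega : measurableType d}
  {T1 : measurableType d1} {S : measurableType d2}.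
Variables (P : probability Omega R) (nu : probability S R).
Variables (tr : Omega -> T1) (V : nat -> Omega -> S) (a : S -> bool).
Variables (sc : T1 * S -> R) (n gap : nat) (b kap : R).
Hypotheses (mtr : measurable_fun [set: Omega] tr)
  (mV : forall j, measurable_fun [set: Omega] (V j))
  (ma : measurable_fun [set: S] a) (msc : measurable_fun [set: T1 * S] sc).
Hypotheses (n0 : (0 < n)%N) (b0 : 0 <= b) (kap01 : 0 <= kap <= 1).
Hypothesis decoupled : forall j l, (j < n)%N -> (l < n)%N -> (j + gap <= l)%N ->
  forall f : (T1 * S) * S -> R, bmf f -> (forall z, `|f z| <= 1) ->
  mean P (fun w => f ((tr w, V j w), V l w)) <=
  mean P (fun w => mean nu (fun y => f ((tr w, V j w), y))) + 2 * b.

(** With [<%R] for [r], a nonnegative value says that at least a fraction [kap] of the calibration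
    points in [a] score below [z]. The relation is a parameter because passing to the negated score
    exchanges strict and weak comparison. *)
Definition excess (r : rel R) (w : Omega) (z : S) : R :=
  \sum_(j < n) ((a (V j w) && r (sc (tr w, V j w)) (sc (tr w, z)))%:R
                - kap * (a (V j w))%:R).

Lemma measurable_excess (r : rel R) :
  (forall f h : Omega * S -> R, measurable_fun [set: Omega * S] f ->
    measurable_fun [set: Omega * S] h ->
    measurable_fun [set: Omega * S] (fun x => r (f x) (h x))) ->
  measurable_fun [set: Omega * S] (fun x => excess r x.1 x.2).
Proof.
move=> mr; apply: measurable_sum => j.
have maV : measurable_fun [set: Omega * S] (fun x => a (V j x.1)).
  by apply: (measurableT_comp ma); exact: measurableT_comp.
apply: measurable_funB; last first.
  by apply: measurable_funM; [exact: measurable_cst|exact: (bmf_bool _ maV).1].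
apply: (bmf_bool _ _).1; apply: measurable_and => //; apply: mr.
  by apply: (measurableT_comp msc); apply: measurable_fun_pair; exact: measurableT_comp.
apply: (measurableT_comp msc); apply: measurable_fun_pair; last exact: measurable_snd.
exact: measurableT_comp.
Qed.

Let p : R := mean nu (fun z => (a z)%:R).
Let rk (x : T1 * S) : R := rank nu a (fun y => sc (x.1, y)) x.2.

Let mcmp {d' : measure_display} {T : measurableType d'} (f h : T -> R) :
  measurable_fun [set: T] f -> measurable_fun [set: T] h ->
  measurable_fun [set: T] (fun x => f x < h x).
Proof. by move=> mf mh; exact: measurable_fun_ltr. Qed.

Let msct (t : T1) : measurable_fun [set: S] (fun y => sc (t, y)).
Proof. exact: (measurableT_comp msc (pair1_measurable _)). Qed.

Let brk : bmf rk.
Proof.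
have m1 : measurable_fun [set: (T1 * S) * S] (fun x : (T1 * S) * S => (x.1.1, x.1.2)).
  by apply: measurable_fun_pair; exact: measurableT_comp.
have m2 : measurable_fun [set: (T1 * S) * S] (fun x : (T1 * S) * S => (x.1.1, x.2)).
  by apply: measurable_fun_pair; [exact: measurableT_comp|exact: measurable_snd].
apply: (bmf_mean nu (fun x : (T1 * S) * S =>
  (a x.2 && (sc (x.1.1, x.2) <= sc (x.1.1, x.1.2)))%:R)).
apply: bmf_bool; apply: measurable_and; first exact: measurableT_comp.
by apply: measurable_fun_ler; exact: measurableT_comp.
Qed.

Let mrkt (t : T1) : measurable_fun [set: S] (rank nu a (fun y => sc (t, y))).
Proof. exact: (measurableT_comp brk.1 (pair1_measurable t)). Qed.

(* Thresholding ranks instead of scores replaces the conditional u-quantile of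
   the score, and stays correct when the score has atoms. *)
Let xi (u : R) (x : T1 * S) : R := (a x.2 && (rk x < u))%:R - kap * (a x.2)%:R.

Let bxi u : bmf (xi u).
Proof.
have ma2 : measurable_fun [set: T1 * S] (fun x => a x.2) by exact: measurableT_comp.
apply: bmfB; last by apply: bmfM; [exact: bmf_cst|exact: bmf_bool].
apply/bmf_bool/measurable_and => //; apply: mcmp; first exact: brk.1.
exact: measurable_cst.
Qed.

Let bxit u t : bmf (fun z => xi u (t, z)).
Proof. exact: (bmf_comp _ _ (bxi u) (pair1_measurable t)). Qed.

Let xi_itv u x : - kap <= xi u x <= 1 - kap.
Proof.
have /andP[? ?] := kap01; rewrite /xi.
by case: (a x.2) => /=; case: (rk x < u) => /=; apply/andP; split; lra.
Qed.

Let mu u (t : T1) : R := mean nu (fun z => xi u (t, z)).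

Let bmu u : bmf (mu u). Proof. exact: bmf_mean. Qed.

Let mu_itv u t : - kap <= mu u t <= 1 - kap.
Proof.
apply/andP; split.
  rewrite -[leLHS](mean_cst nu); apply: le_mean => //; first exact: bmf_cst.
  by move=> z; have /andP[] := xi_itv u (t, z).
rewrite -[leRHS](mean_cst nu); apply: le_mean => //; first exact: bmf_cst.
by move=> z; have /andP[] := xi_itv u (t, z).
Qed.

(** Superuniformity of the rank, applied at each fixed training sample [t]. *)
Let mu_le u t : 0 <= u -> mu u t <= u - kap * p.
Proof.
move=> u0; rewrite /mu /xi meanB.
- rewrite meanZ; last exact: bmf_bool.
  rewrite /= -/p lerD2r.
  exact: (rank_superuniform nu a (fun y => sc (t, y)) ma (msct t) (mrkt t) u u0).
- apply/bmf_bool/measurable_and => //; apply: mcmp; first exact: mrkt.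
  exact: measurable_cst.
- by apply: bmfM; [exact: bmf_cst|exact: bmf_bool].
Qed.

(** Centring at the mean given the training data, not at the overall mean, makes the integral over
    [nu] vanish for every [t]. *)
Let psi u (x : T1 * S) : R := xi u x - mu u x.1.

Let bpsi u : bmf (psi u).
Proof. by apply: bmfB => //; exact: (bmf_comp _ fst (bmu u) measurable_fst). Qed.

Let psi1 u x : `|psi u x| <= 1.
Proof.
have := xi_itv u x; have := mu_itv u x.1; rewrite ler_norml /psi.
by move=> /andP[? ?] /andP[? ?]; apply/andP; split; lra.
Qed.

Let mean_psi u t : mean nu (fun z => psi u (t, z)) = 0.
Proof. by rewrite /psi/= meanB ?mean_cst ?subrr//; exact: bmf_cst. Qed.

Let trV j w : T1 * S := (tr w, V j w).

Let mtrV j : measurable_fun [set: Omega] (trV j).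
Proof. exact: measurable_fun_pair. Qed.

Let D u w : R := \sum_(j < n) xi u (trV j w).

Let mD u : measurable_fun [set: Omega] (D u).
Proof. by apply: measurable_sum => j; exact: (measurableT_comp (bxi u).1 (mtrV j)). Qed.

(** Replacing the later [V l] by an independent draw from [nu], jointly against the training data
    and [V j], costs at most [2 * b]; the product then has mean zero by [mean_psi]. *)
Let second_moment u :
  mean P (fun w => (\sum_(j < n) psi u (trV j w)) ^+ 2) <=
  2 * gap%:R * n%:R + 2 * b * n%:R ^+ 2.
Proof.
apply: (second_moment_le P (fun j w => psi u (trV j w)) n gap (2 * b)).
- by move=> j; exact: (bmf_comp _ _ (bpsi u) (mtrV j)).
- by move=> j w; exact: psi1.
- by rewrite mulr_ge0.
move=> j l jn ln jl.
pose f (x : (T1 * S) * S) := psi u x.1 * psi u (x.1.1, x.2).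
have bf : bmf f.
  apply: bmfM; first exact: (bmf_comp _ fst (bpsi u) measurable_fst).
  apply: (bmf_comp (psi u) (fun x : (T1 * S) * S => (x.1.1, x.2)) (bpsi u)).
  apply: measurable_fun_pair; last exact: measurable_snd.
  exact: measurableT_comp.
have f1 x : `|f x| <= 1 by rewrite normrM mulr_ile1.
rewrite (le_trans (decoupled _ _ jn ln jl f bf f1))//.
rewrite (_ : (fun w => mean nu _) = fun=> 0) ?mean_cst ?add0r//.
apply/funext => w; rewrite /f/= meanZ ?mean_psi ?mulr0//.
exact: (bmf_comp _ _ (bpsi u) (pair1_measurable (tr w))).
Qed.

(** The choice of [u] makes [n * mu] at most [- gap - n * x], so on the event the sum of the [psi]
    is at least [n * x] and Chebyshev's inequality applies. *)
Let D_tail u (x : R) : 0 <= u -> 0 < x -> u = kap * p - gap%:R / n%:R - x ->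
  mean P (fun w => (- gap%:R <= D u w)%R%:R) <= (2 * gap%:R / n%:R + 2 * b) / x ^+ 2.
Proof.
move=> u0 x0 uE; have nR0 : (0 : R) < n%:R by rewrite ltr0n.
have -> : (2 * gap%:R / n%:R + 2 * b) / x ^+ 2 =
    (2 * gap%:R * n%:R + 2 * b * n%:R ^+ 2) / (n%:R * x) ^+ 2.
  by field; apply/andP; split; lra.
apply: (mean_bool_le_sqr _ _ (fun w => \sum_(j < n) psi u (trV j w))) => //.
- by apply: measurable_fun_ler => //; exact: measurable_cst.
- by apply: bmf_sum => j; exact: (bmf_comp _ _ (bpsi u) (mtrV j)).
- by rewrite mulr_gt0.
move=> w Dw; rewrite /psi sumrB/= -/(D u w) sumr_const card_ord -mulr_natl.
have := ler_wpM2l (ltW nR0) (mu_le u (tr w) u0).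
have -> : n%:R * (u - kap * p) = - gap%:R - n%:R * x by rewrite uE; field; lra.
by move: Dw; lra.
Qed.

Let risk (w : Omega) : R := mean nu (fun z => (a z && (- gap%:R <= excess <%R w z))%:R).

Let mriskb : measurable_fun [set: Omega * S] (fun x => a x.2 && (- gap%:R <= excess <%R x.1 x.2)).
Proof.
apply: measurable_and; first exact: measurableT_comp.
apply: measurable_fun_ler; first exact: measurable_cst.
by apply: measurable_excess => f h; exact: measurable_fun_ltr.
Qed.

Let briskw w : bmf (fun z => (a z && (- gap%:R <= excess <%R w z))%:R : R).
Proof. exact/bmf_bool/(measurableT_comp mriskb (pair1_measurable w)). Qed.

Let brisk : bmf risk.
Proof. exact: (bmf_mean nu (fun x => (a x.2 && (- gap%:R <= excess <%R x.1 x.2))%:R)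
  (bmf_bool _ mriskb)). Qed.

(* When D u w < - gap, every z counted in the risk scores above some calibration
   point of A of rank at least u; take the lowest such point. *)
Let risk_le u w : u <= p -> ~~ (- gap%:R <= D u w) -> risk w <= p - u.
Proof.
move=> up Dw.
have above z : - gap%:R <= excess <%R w z -> exists2 j : 'I_n,
    a (V j w) && (u <= rk (trV j w)) & sc (trV j w) < sc (tr w, z).
  (* Without such a [j], every term of the excess is at most the matching term of [D u w], against
     [Dw]. *)
  move=> ez; apply: contrapT => noj; move/negP: Dw; apply.
  rewrite (le_trans ez)//; apply: ler_sum => j _; rewrite lerD2r /=.
  case: (boolP (a (V j w))) => //= aj; rewrite ler_nat.
  have [_|ju] := ltP (rk (trV j w)) u; first exact: leq_b1.
  case: ltP => // jz; case: noj; exists j => //.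
  by rewrite aj.
have [[i0 i0P]|noi] := pselect (exists i : 'I_n, a (V i w) && (u <= rk (trV i w))).
  case: (@arg_minP _ _ _ i0 (fun i => a (V i w) && (u <= rk (trV i w)))
    (fun i => sc (trV i w)) i0P) => i /andP[_ ui] imin.
  (* Points counted in the risk score above [V i], hence avoid the part of [a] scoring at most as
     high, whose mass is the rank of [V i], at least [u]. *)
  rewrite lerBrDr (le_trans (lerD (lexx _) ui))// /rk /rank/= /p -meanD//; last first.
    apply/bmf_bool/measurable_and => //.
    by apply: measurable_fun_ler; [exact: msct|exact: measurable_cst].
  apply: le_mean; [|exact: bmf_bool|move=> z].
    apply: bmfD => //; apply/bmf_bool/measurable_and => //.
    by apply: measurable_fun_ler; [exact: msct|exact: measurable_cst].
  case: (a z) => /=; last by rewrite addr0.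
  case: (boolP (- gap%:R <= excess <%R w z)) => [/above[j jP jz]|_]; last first.
    by rewrite add0r lern1 leq_b1.
  have lti : sc (trV i w) < sc (tr w, z) := le_lt_trans (imin j jP) jz.
  by rewrite [sc _ <= _](lt_geF lti) addr0.
rewrite (_ : risk w = 0) ?subr_ge0// /risk (_ : (fun z => _) = fun=> 0) ?mean_cst//.
apply/funext => z; case: (boolP (- gap%:R <= excess <%R w z)) => [/above[j jP _]|_].
  by case: noi; exists j.
by rewrite andbF.
Qed.

(** The terms of the bound are the target mass, the slack from the threshold [- gap], the step
    between levels, and the sum of the Chebyshev tails. *)
Lemma calibration_risk_le (sg : R) : 0 < sg ->
  mean P (fun w => mean nu (fun z => (a z && (- gap%:R <= excess <%R w z))%:R)) <=
  (1 - kap) * p + gap%:R / n%:R + sg + 2 * (2 * gap%:R / n%:R + 2 * b) / sg.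
Proof.
move=> sg0; rewrite -/risk; have /andP[kap0 kap1] := kap01.
have p0 : 0 <= p by apply: mean_ge0 => z; exact: ler0n.
have nR0 : (0 : R) < n%:R by rewrite ltr0n.
set V0 := 2 * gap%:R / n%:R + 2 * b.
have V00 : 0 <= V0 by rewrite addr_ge0 ?mulr_ge0// invr_ge0 ltW.
have gn0 : 0 <= gap%:R / n%:R :> R by rewrite mulr_ge0// invr_ge0 ltW.
(* The first level k with D (u k) w < - gap gives risk w <= p - u k, and each
   earlier level fails with probability at most V0 / (sg * k) ^+ 2. *)
pose c := kap * p - gap%:R / n%:R; pose u k := c - sg * k%:R.
have cp : c <= p by rewrite /c; nra.
(* The levels stop at the first negative one: superuniformity needs [0 <= u], and at a negative
   level the trivial bound [risk w <= p] is enough. *)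
have [K uK0 Kmin] : exists2 K, u K < 0 & forall k, (k < K)%N -> 0 <= u k.
  have exK : exists k, u k < 0.
    exists (Num.Def.truncn (c / sg)).+1; rewrite subr_lt0 mulrC -ltr_pdivrMr//.
    by rewrite truncnS_gt.
  case: (ex_minnP exK) => K uK Kmin; exists K => // k kK.
  by rewrite leNgt; apply/negP => /Kmin; rewrite leqNgt kK.
pose ev k w := - gap%:R <= D (u k) w.
have mev k : measurable_fun [set: Omega] (ev k).
  by apply: measurable_fun_ler => //; exact: measurable_cst.
have bev k : bmf (fun w => (ev k w)%:R : R) by exact: bmf_bool.
have bsum : bmf (fun w => sg * \sum_(k < K) (ev k w)%:R : R).
  by apply: bmfM; [exact: bmf_cst|exact: bmf_sum].
have risk_p w : risk w <= p.
  apply: le_mean => //; first exact: bmf_bool.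
  by move=> z; case: (a z) => /=; rewrite ?ler_nat ?leq_b1.
have -> : (1 - kap) * p + gap%:R / n%:R + sg + 2 * V0 / sg = p - c + (sg + 2 * V0 / sg).
  by rewrite /c; ring.
apply: (@le_trans _ _ (mean P (fun w => p - c + sg * \sum_(k < K) (ev k w)%:R))).
  apply: le_mean => [//||w]; first by apply: bmfD => //; exact: bmf_cst.
  apply: (first_failure_le _ (fun k => ev k w) (p - c) sg (risk w) K) => [|k kK nev|].
  - exact: ltW.
  - have -> : p - c + sg * k%:R = p - u k by rewrite /u; ring.
    apply: risk_le => //; apply: le_trans cp.
    by rewrite /u gerBl mulr_ge0// ltW.
  - by rewrite (le_trans (risk_p w))//; move: uK0; rewrite /u; lra.
rewrite meanD//; last exact: bmf_cst.
rewrite mean_cst lerD2l meanZ; last exact: bmf_sum.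
rewrite mean_sum//; case: K uK0 Kmin {bsum} => [|K] _ Kmin.
  by rewrite big_ord0 mulr0 addr_ge0 ?(ltW sg0)// !mulr_ge0// invr_ge0 ltW.
(* Level [0] leaves no deviation for Chebyshev's inequality; its probability is bounded by [1],
   which gives the summand [sg]. *)
rewrite big_ord_recl mulrDr lerD//.
  rewrite ler_piMr ?(ltW sg0)//; apply: mean_le1 => // w.
  by rewrite lern1 leq_b1.
rewrite (@le_trans _ _ (sg * \sum_(k < K) (V0 / sg ^+ 2 * k.+1%:R ^- 2)))//.
  rewrite ler_wpM2l ?(ltW sg0)//; apply: ler_sum => k _.
  have sk0 : 0 < sg * k.+1%:R by rewrite mulr_gt0 ?ltr0n.
  have -> : V0 / sg ^+ 2 * k.+1%:R ^- 2 = V0 / (sg * k.+1%:R) ^+ 2.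
    by rewrite exprMn (invfM (sg ^+ 2)) mulrA.
  exact: (D_tail (u k.+1) _ (Kmin k.+1 (ltn_ord k)) sk0 erefl).
rewrite -mulr_sumr mulrA (_ : sg * (V0 / sg ^+ 2) = V0 / sg); last first.
  by field; rewrite gt_eqF.
rewrite [leRHS](_ : _ = V0 / sg * 2); last by ring.
by rewrite ler_wpM2l ?sum_inv_sqr_le2// mulr_ge0// invr_ge0 ltW.
Qed.

End CalibrationRisk.

(** * Mixing *)

Section Law.
Context {R : realType} {d d1 : measure_display} {Omega : measurableType d}
  {T : measurableType d1}.
Variable P : probability Omega R.

Definition law (X : Omega -> T) (mX : measurable_fun [set: Omega] X) :
  probability T R := distribution P (mfun_Sub (mem_set mX)).

Lemma mean_law X (mX : measurable_fun [set: Omega] X) (f : T -> R) :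
  bmf f -> mean (law X mX) f = mean P (fun w => f (X w)).
Proof.
move=> bf; have bfX : bmf (fun w => f (X w)) by exact: (bmf_comp f X bf mX).
rewrite /mean /Rintegral integral_distribution//.
  exact/measurable_EFinP/bf.1.
exact: (bmf_integrable P _ bfX).
Qed.

Lemma mean_eq_law (X Y : Omega -> T) (f : T -> R) :
  measurable_fun [set: Omega] X -> measurable_fun [set: Omega] Y ->
  (forall B, measurable B -> P (X @^-1` B) = P (Y @^-1` B)) -> bmf f ->
  mean P (fun w => f (X w)) = mean P (fun w => f (Y w)).
Proof.
move=> mX mY XY bf; rewrite -(mean_law X mX)// -(mean_law Y mY)// /mean /Rintegral.
by congr fine; apply: eq_measure_integral => B mB _; exact: XY.
Qed.

End Law.

Section Mixing.
Context {R : realType} {d dX dY : measure_display} {Omega : measurableType d}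
  {TX : measurableType dX} {TY : measurableType dY}.
Variables (P : probability Omega R) (Z : int -> Omega -> (TX * TY)%type).
Hypothesis mZ : process_measurable Z.

Definition sample {k : nat} (ts : k.-tuple int) (w : Omega) : k.-tuple (TX * TY)%type :=
  map_tuple (fun t => Z t w) ts.

Lemma measurable_sample {k} (ts : k.-tuple int) : measurable_fun [set: Omega] (sample ts).
Proof.
apply/measurable_fun_tnthP => i.
by rewrite (_ : _ \o _ = Z (tnth ts i)) //; apply/funext => w /=; rewrite tnth_map.
Qed.

Let block (I : set int) : set (set Omega) :=
  [set E | exists t, I t /\ exists B, measurable B /\ E = Z t @^-1` B].

Lemma sigma_block_measurable (I : set int) E : sigma_block Z I E -> measurable E.
Proof.
move=> sE; suff : (@measurable d Omega) E by [].
move: E sE; apply: smallest_sub; first exact: sigma_algebra_measurable.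
move=> _ [t [_ [B [mB ->]]]]; rewrite -[X in measurable X]setTI; exact: mZ.
Qed.

Lemma prod_sigma_measurable (I J : set int) E :
  prod_sigma (sigma_block Z I) (sigma_block Z J) E -> measurable E.
Proof.
move: E; apply: smallest_sub; first exact: sigma_algebra_measurable.
move=> _ [E1 [E2 [/sigma_block_measurable m1 [/sigma_block_measurable m2 ->]]]].
exact: measurableX.
Qed.

(** Once [Omega] carries the sigma-algebra of the respective block, [sample ts] and [Z t] are
    measurable, and the event is a preimage under the pair of them. *)
Lemma sample_prod_sigma {k} (I J : set int) (ts : k.-tuple int) (t : int)
    (c : k.-tuple (TX * TY)%type * (TX * TY)%type -> bool) :
  (forall i, I (tnth ts i)) -> J t -> measurable_fun setT c ->
  prod_sigma (sigma_block Z I) (sigma_block Z J)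
    [set x | c (sample ts x.1, Z t x.2)].
Proof.
move=> Its Jt mc.
pose O1 := g_sigma_algebraType (block I); pose O2 := g_sigma_algebraType (block J).
have m1 : measurable_fun [set: O1] (sample ts : O1 -> _).
  apply/measurable_fun_tnthP => i.
  rewrite (_ : _ \o _ = Z (tnth ts i)); last first.
    by apply/funext => w /=; rewrite tnth_map.
  move=> _ B mB; rewrite setTI; apply: sub_sigma_algebra.
  by exists (tnth ts i); split => //; exists B.
have m2 : measurable_fun [set: O2] (Z t : O2 -> _).
  move=> _ B mB; rewrite setTI; apply: sub_sigma_algebra.
  by exists t; split => //; exists B.
have mpair : measurable_fun [set: (O1 * O2)%type]
    (fun x : O1 * O2 => (sample ts x.1, Z t x.2)).
  apply: measurable_fun_pair.
    exact: (measurableT_comp m1 measurable_fst).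
  exact: (measurableT_comp m2 measurable_snd).
have : measurable ([set: (O1 * O2)%type] `&`
    (fun x : O1 * O2 => c (sample ts x.1, Z t x.2)) @^-1` [set true]).
  by apply: (measurableT_comp mc mpair).
rewrite setTI measurable_prod_measurableType.
rewrite /prod_sigma; set G1 := (X in <<s X >> _ -> _); set G2 := (X in _ -> <<s X >> _).
suff -> : G1 = G2 by [].
apply/seteqP; split => [_ [A1 mA1 [A2 mA2 <-]]|_ [A1 [A2 [mA1 [mA2 ->]]]]].
  by exists A1, A2.
by exists A1 => //; exists A2.
Qed.

Let bindic (E : set (Omega * Omega)) : measurable E ->
  bmf (fun x => (x \in E)%:R : R).
Proof. by move=> mE; exact/bmf_bool/measurable_mem. Qed.

Let tvE (E : set (Omega * Omega)) : measurable E ->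
  `| P [set w | E (w, w)] - \int[P]_w P [set w' | E (w, w')] |%E =
  `| mean P (fun w => ((w, w) \in E)%:R)
     - mean P (fun w => mean P (fun w' => ((w, w') \in E)%:R)) |%:E.
Proof.
move=> mE.
have mdiag : measurable_fun [set: Omega] (fun w : Omega => (w, w) \in E).
  apply: (measurableT_comp (measurable_mem E mE)).
  exact: measurable_fun_pair.
have mpair w : measurable_fun [set: Omega] (fun w' : Omega => (w, w') \in E).
  exact: (measurableT_comp (measurable_mem E mE) (pair1_measurable w)).
have PE (Q : set Omega) (q : Omega -> bool) : measurable_fun [set: Omega] q ->
    (forall w, Q w <-> q w) -> P Q = (mean P (fun w => (q w)%:R))%:E.
  move=> mq Qq; have -> : Q = [set w | q w] by apply/seteqP; split => w /Qq.
  rewrite mean_bool// fineK// fin_num_measure//.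
  by rewrite -[X in measurable X]setTI; exact: (mq measurableT [set true]).
rewrite (PE _ (fun w => (w, w) \in E)) => [|//|w]; last first.
  by split => [/mem_set|/set_mem].
under eq_integral => w _ do rewrite (PE _ (fun w' => (w, w') \in E) (mpair w)
  (fun w' => conj (@mem_set _ E (w, w')) (@set_mem _ E (w, w')))).
rewrite -EFin_mean//; exact: (bmf_mean P _ (bindic E mE)).
Qed.

Lemma le_beta_coef (a : nat) (E : set (Omega * Omega)) :
  prod_sigma (sigma_block Z [set t | t <= 0]) (sigma_block Z [set t | a%:Z <= t]) E ->
  `| mean P (fun w => ((w, w) \in E)%:R)
     - mean P (fun w => mean P (fun w' => ((w, w') \in E)%:R)) | <= beta_coef P Z a.
Proof.
move=> sE; rewrite -lee_fin -tvE; last exact: prod_sigma_measurable sE.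
rewrite /beta_coef; set SS := [set _ | _ in _].
have SSE : SS `| P [set w | E (w, w)] - \int[P]_w P [set w' | E (w, w')] |%E by exists E.
(* [fine] sends infinite values to [0], so the supremum must first be shown finite: every
   discrepancy lies between [0] and [1]. *)
have le1 x : SS x -> (0 <= x <= 1)%E.
  move=> [F /prod_sigma_measurable mF <-]; rewrite tvE// !lee_fin normr_ge0/=.
  have bF := bindic F mF.
  have bdiag : bmf (fun w => ((w, w) \in F)%:R : R).
    by apply: (bmf_comp _ _ bF); exact: measurable_fun_pair.
  have bpair w : bmf (fun w' => ((w, w') \in F)%:R : R).
    exact: (bmf_comp _ _ bF (pair1_measurable w)).
  have ind1 (v : Omega * Omega) : (v \in F)%:R <= 1 :> R by rewrite lern1 leq_b1.
  rewrite ler_norml.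
  have m1 := mean_le1 P _ bdiag (fun w => ind1 (w, w)).
  have m0 : 0 <= mean P (fun w => ((w, w) \in F)%:R) by apply: mean_ge0 => w; exact: ler0n.
  have n1 := mean_le1 P _ (bmf_mean P _ bF)
    (fun w => mean_le1 P _ (bpair w) (fun w' => ind1 (w, w'))).
  have n0 : 0 <= mean P (fun w => mean P (fun w' => ((w, w') \in F)%:R)).
    by apply: mean_ge0 => w; apply: mean_ge0 => w'; exact: ler0n.
  by apply/andP; split; lra.
have sup_ge := ereal_sup_ubound SSE; rewrite fineK//.
rewrite ge0_fin_numE; last by apply: le_trans sup_ge; have /andP[] := le1 _ SSE.
by apply: (@le_lt_trans _ _ 1%E); [apply: ge_ereal_sup => x /le1/andP[]|exact: ltry].
Qed.

End Mixing.

Section Decoupling.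
Context {R : realType} {d dX dY : measure_display} {Omega : measurableType d}
  {TX : measurableType dX} {TY : measurableType dY}.
Variables (P : probability Omega R) (Z : int -> Omega -> (TX * TY)%type).
Hypotheses (mZ : process_measurable Z) (statZ : stationary P Z).
Let S : measurableType _ := (TX * TY)%type.

Lemma mean_shift {k} (ts : k.-tuple int) (h : int) (f : k.-tuple S -> R) : bmf f ->
  mean P (fun w => f (sample Z ts w)) =
  mean P (fun w => f (sample Z (map_tuple (fun t => t + h) ts) w)).
Proof.
apply: mean_eq_law; [exact: measurable_sample|exact: measurable_sample|].
move=> B mB; rewrite [LHS](statZ _ ts h B mB); congr (P _).
apply/funext => w /=; congr (B _).
by apply: val_inj; rewrite /= -map_comp.
Qed.

Lemma mean_marginal (t u : int) (f : S -> R) : bmf f ->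
  mean P (fun w => f (Z t w)) = mean P (fun w => f (Z u w)).
Proof.
move=> bf.
have bh : bmf (fun v : 1.-tuple S => f (tnth v ord0)).
  exact: (bmf_comp f _ bf (measurable_tnth ord0)).
have := mean_shift [tuple t] (u - t) _ bh.
have sE v w : tnth (sample Z [tuple v] w) ord0 = Z v w by rewrite tnth_map.
have -> : map_tuple (fun v => v + (u - t)) [tuple t] = [tuple u].
  by apply: val_inj; rewrite /= addrC subrK.
under eq_fun do rewrite sE.
by under [in RHS]eq_fun do rewrite sE.
Qed.

(** Shifting time by [- T] places the sample at times up to [0] and the single point at a time at
    least [a], as in [beta_coef]; stationarity preserves both means. Only one side of the absolute
    value is kept. *)
Lemma decoupled_sample {k} (ts : k.-tuple int) (t T : int) (a : nat)
    (c : k.-tuple S * S -> bool) :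
  (forall i, tnth ts i <= T) -> T + a%:Z <= t -> measurable_fun setT c ->
  mean P (fun w => (c (sample Z ts w, Z t w))%:R) <=
  mean P (fun w => mean (law P (Z 1) (mZ 1)) (fun y => (c (sample Z ts w, y))%:R))
  + beta_coef P Z a.
Proof.
move=> tsT Tt mc; pose sh := map_tuple (fun u => u - T) ts.
have bc : bmf (fun x => (c x)%:R : R) by exact: bmf_bool.
have bcx x : bmf (fun y => (c (x, y))%:R : R).
  exact: (bmf_comp _ _ bc (pair1_measurable x)).
have -> : mean P (fun w => (c (sample Z ts w, Z t w))%:R) =
    mean P (fun w => (c (sample Z sh w, Z (t - T) w))%:R).
  have bf : bmf (fun v : k.+1.-tuple S => (c ([tuple of behead v], tnth v ord0))%:R : R).
    apply: (bmf_comp (fun x => (c x)%:R) _ bc).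
    by apply: measurable_fun_pair; [exact: measurable_behead|exact: measurable_tnth].
  have := mean_shift (cons_tuple t ts) (- T) _ bf.
  have beh (u : int) (us : k.-tuple int) w :
      [tuple of behead (sample Z (cons_tuple u us) w)] = sample Z us w.
    exact: val_inj.
  under eq_fun do rewrite beh.
  rewrite (_ : map_tuple _ (cons_tuple t ts) = cons_tuple (t - T) sh); last exact: val_inj.
  by under [in RHS]eq_fun do rewrite beh.
have -> : mean P (fun w => mean (law P (Z 1) (mZ 1)) (fun y => (c (sample Z ts w, y))%:R)) =
    mean P (fun w => mean P (fun w' => (c (sample Z sh w, Z (t - T) w'))%:R)).
  rewrite [LHS](mean_shift ts (- T) (fun x => mean (law P (Z 1) (mZ 1)) (fun y => (c (x, y))%:R))).
    congr (mean P _); apply/funext => w; rewrite mean_law//.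
    exact: (mean_marginal _ _ (fun y => (c (sample Z sh w, y))%:R)).
  exact: (bmf_mean _ (fun x => (c x)%:R) bc).
have sh0 i : [set u : int | u <= 0] (tnth sh i) by rewrite /= tnth_map subr_le0.
have tT : [set u : int | a%:Z <= u] (t - T) by rewrite /= lerBrDl.
have := le_beta_coef P Z mZ a _ (sample_prod_sigma Z _ _ sh (t - T) c sh0 tT mc).
have inE x : (x \in [set x | c (sample Z sh x.1, Z (t - T) x.2)]) =
    c (sample Z sh x.1, Z (t - T) x.2).
  by apply/idP/idP => [/set_mem|cx]; last exact: mem_set.
have -> : (fun w => ((w, w) \in [set x | c (sample Z sh x.1, Z (t - T) x.2)])%:R) =
    fun w => (c (sample Z sh w, Z (t - T) w))%:R :> R.
  by apply/funext => w; rewrite inE.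
have -> : (fun w => mean P (fun w' =>
      ((w, w') \in [set x | c (sample Z sh x.1, Z (t - T) x.2)])%:R)) =
    fun w => mean P (fun w' => (c (sample Z sh w, Z (t - T) w'))%:R).
  by apply/funext => w; congr (mean P _); apply/funext => w'; rewrite inE.
by rewrite ler_norml => /andP[_]; rewrite lerBlDl.
Qed.

Lemma decoupled_sym_sample {k} (ts : k.-tuple int) (t T : int) (a : nat)
    (f : k.-tuple S * S -> R) :
  (forall i, tnth ts i <= T) -> T + a%:Z <= t -> bmf f -> (forall x, `|f x| <= 1) ->
  mean P (fun w => f (sample Z ts w, Z t w)) <=
  mean P (fun w => mean (law P (Z 1) (mZ 1)) (fun y => f (sample Z ts w, y)))
  + 2 * beta_coef P Z a.
Proof.
move=> tsT Tt; apply: decoupled_sym; [exact: measurable_sample|exact: mZ|].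
by move=> c; exact: (decoupled_sample ts t T a c tsT Tt).
Qed.

End Decoupling.

Lemma measurable_nth {d : measure_display} {T : measurableType d} (N m : nat) :
  measurable_fun [set: (N.-tuple T * T)%type] (fun x : N.-tuple T * T => nth x.2 x.1 m).
Proof.
have [mN|Nm] := ltnP m N; last first.
  rewrite (_ : (fun x => _) = snd); first exact: measurable_snd.
  by apply/funext => x; rewrite nth_default// size_tuple.
rewrite (_ : (fun x => _) = (fun x => tnth x.1 (Ordinal mN))); last first.
  by apply/funext => x; rewrite (tnth_nth x.2).
exact: (measurableT_comp (measurable_tnth _) measurable_fst).
Qed.

(** * Calibration risk of a stationary process *)

Section ProcessRisk.
Context {R : realType} {d dX dY : measure_display} {Omega : measurableType d}
  {TX : measurableType dX} {TY : measurableType dY}.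
Variables (P : probability Omega R) (Z : int -> Omega -> (TX * TY)%type).
Hypotheses (mZ : process_measurable Z) (statZ : stationary P Z).
Let S : measurableType _ := (TX * TY)%type.
Let nu : probability S R := law P (Z 1) (mZ 1).
Variables (ntr n gap : nat) (a : S -> bool) (sc : ntr.-tuple S * S -> R) (kap : R).
Hypotheses (ma : measurable_fun [set: S] a)
  (msc : measurable_fun [set: (ntr.-tuple S * S)%type] sc).

Definition train_times : ntr.-tuple int := mktuple (fun i : 'I_ntr => Posz i.+1).
Definition train (w : Omega) : ntr.-tuple S := sample Z train_times w.
(** Indices start at [0]: [calib 0] is observation [ntr + 1], the first of [I_cal]. *)
Definition calib (j : nat) : Omega -> S := Z (Posz (ntr + j).+1).

Lemma beta_coef_ge0 (k : nat) : 0 <= beta_coef P Z k.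
Proof.
apply: (le_trans (normr_ge0 _) (le_beta_coef P Z mZ k set0 _)).
exact: sigma_algebra0.
Qed.

Lemma process_calibration_risk (sg : R) : (0 < n)%N -> 0 <= kap <= 1 -> 0 < sg ->
  mean P (fun w => mean nu (fun z =>
    (a z && (- gap%:R <= excess train calib a sc n kap <%R w z))%:R)) <=
  (1 - kap) * mean nu (fun z => (a z)%:R) + gap%:R / n%:R + sg
  + 2 * (2 * gap%:R / n%:R + 2 * beta_coef P Z gap) / sg.
Proof.
move=> n0 kap01; apply: calibration_risk_le => //.
- exact: measurable_sample.
- by move=> j; exact: mZ.
- exact: beta_coef_ge0.
move=> j l _ _ jl f bf f1.
(* The training data and [calib j] are read off one sample with the calibration time at its head.
   Its times are at most [ntr + j + 1], hence at least [gap] before that of [calib l]. *)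
pose f' (x : (ntr.+1).-tuple S * S) := f (([tuple of behead x.1], tnth x.1 ord0), x.2).
have bf' : bmf f'.
  apply: (bmf_comp f (fun x : (ntr.+1).-tuple S * S =>
    (([tuple of behead x.1], tnth x.1 ord0), x.2)) bf).
  apply: measurable_fun_pair; last exact: measurable_snd.
  apply: measurable_fun_pair.
    have mb : measurable_fun [set: (ntr.+1).-tuple S] (fun v => [tuple of behead v]).
      exact: measurable_behead.
    exact: (measurableT_comp mb measurable_fst).
  have mt : measurable_fun [set: (ntr.+1).-tuple S] (fun v => tnth v ord0).
    exact: (measurable_tnth ord0).
  exact: (measurableT_comp mt measurable_fst).
have := decoupled_sym_sample P Z mZ statZ
  (cons_tuple (Posz (ntr + j).+1) train_times) (Posz (ntr + l).+1)
  (Posz (ntr + j).+1) gap f'.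
have sE w : ([tuple of behead (sample Z (cons_tuple (Posz (ntr + j).+1) train_times) w)],
    tnth (sample Z (cons_tuple (Posz (ntr + j).+1) train_times) w) ord0) =
    (train w, calib j w).
  by congr (_, _); exact: val_inj.
set ts := cons_tuple _ _.
have f'E w y : f' (sample Z ts w, y) = f ((train w, calib j w), y) by rewrite /f' sE.
have -> : (fun w => f' (sample Z ts w, Z (Posz (ntr + l).+1) w)) =
    fun w => f ((train w, calib j w), calib l w).
  by apply/funext => w; rewrite f'E.
have -> : (fun w => mean (law P (Z 1) (mZ 1)) (fun y => f' (sample Z ts w, y))) =
    fun w => mean nu (fun y => f ((train w, calib j w), y)).
  by apply/funext => w; congr (mean _ _); apply/funext => y; rewrite f'E.
apply => //.
  move=> i; case: (unliftP ord0 i) => [i' ->|->]; last by [].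
  rewrite tnthS tnth_mktuple lez_nat ltnS.
  by rewrite (leq_trans (ltnW (ltn_ord i')))// leq_addr.
  by rewrite -PoszD lez_nat; lia.
by move=> x; exact: f1.
Qed.

(** Apart from the test point, the event depends only on the first [ntr + n] observations, all at
    least [gap] before [i]. *)
Lemma test_point_risk (r : rel R) (i : nat) :
  (forall f h : (ntr + n).-tuple S * S * S -> R, measurable_fun setT f ->
    measurable_fun setT h -> measurable_fun setT (fun x => r (f x) (h x))) ->
  (ntr + n + gap <= i)%N ->
  mean P (fun w => (a (Z i w) &&
    (- gap%:R <= excess train calib a sc n kap r w (Z i w)))%:R) <=
  mean P (fun w => mean nu (fun z =>
    (a z && (- gap%:R <= excess train calib a sc n kap r w z))%:R))
  + beta_coef P Z gap.
Proof.
move=> mr igap.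
(* The excess is rebuilt on tuples. The evaluated point is the default of [nth], never reached in
   the excess, whose indices stay below [ntr + n]. *)
pose T' : measurableType _ := ((ntr + n).-tuple S * S)%type.
pose tr' (x : T') : ntr.-tuple S := mktuple (fun k : 'I_ntr => nth x.2 x.1 k).
pose V' (j : nat) (x : T') : S := nth x.2 x.1 (ntr + j).
pose c (x : T') := a x.2 && (- gap%:R <= excess tr' V' a sc n kap r x x.2).
have mtr' : measurable_fun [set: T'] tr'.
  apply/measurable_fun_tnthP => k.
  rewrite (_ : _ \o _ = fun x : T' => nth x.2 x.1 k); first exact: measurable_nth.
  by apply/funext => x; rewrite /= tnth_mktuple.
have mV' j : measurable_fun [set: T'] (V' j) by exact: measurable_nth.
have mc : measurable_fun [set: T'] c.
  apply: measurable_and; first exact: (measurableT_comp ma measurable_snd).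
  apply: measurable_fun_ler; first exact: measurable_cst.
  have mex := measurable_excess tr' V' a sc n kap mtr' mV' ma msc r mr.
  have mdiag : measurable_fun [set: T'] (fun x : T' => (x, x.2)).
    by apply: measurable_fun_pair; [exact: measurable_id|exact: measurable_snd].
  exact: (measurableT_comp mex mdiag).
pose ts : (ntr + n).-tuple int := mktuple (fun k : 'I_(ntr + n) => Posz k.+1).
have nthE w z (k : nat) : (k < ntr + n)%N -> nth z (sample Z ts w) k = Z (Posz k.+1) w.
  move=> kN; rewrite -[k]/(val (Ordinal kN)) -tnth_nth tnth_map.
  by rewrite tnth_mktuple.
have exE w z : excess tr' V' a sc n kap r (sample Z ts w, z) z =
    excess train calib a sc n kap r w z.
  have trE : tr' (sample Z ts w, z) = train w.
    apply: eq_from_tnth => k; rewrite tnth_mktuple nthE; last first.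
      by rewrite (leq_trans (ltn_ord k))// leq_addr.
    by rewrite tnth_map tnth_mktuple.
  apply: eq_bigr => j _; rewrite trE (_ : V' j _ = calib j w)//.
  by rewrite /V' nthE// ltn_add2l.
have := decoupled_sample P Z mZ statZ ts i (Posz (ntr + n)) gap c.
have -> : (fun w => (c (sample Z ts w, Z i w))%:R) = (fun w => (a (Z i w) &&
    (- gap%:R <= excess train calib a sc n kap r w (Z i w)))%:R) :> (Omega -> R).
  by apply/funext => w; rewrite /c exE.
have -> : (fun w => mean (law P (Z 1) (mZ 1)) (fun y => (c (sample Z ts w, y))%:R)) =
    fun w => mean nu (fun z =>
    (a z && (- gap%:R <= excess train calib a sc n kap r w z))%:R).
  by apply/funext => w; congr (mean _ _); apply/funext => z; rewrite /c exE.
apply => //.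
by move=> k; rewrite tnth_mktuple lez_nat.
Qed.

End ProcessRisk.

(** * Coverage *)

(** Finitely many values below [x] have a common bound [t < x]; it turns a strict count at [x] into
    a value of the empirical distribution function at [t]. *)
Lemma exists_below_above (R : realType) (I : Type) (r : seq I) (q : I -> bool)
    (f : I -> R) (x : R) :
  exists2 t, t < x & all (fun j => (q j && (f j < x)) ==> (q j && (f j <= t))) r.
Proof.
elim: r => [|j r [t tx IH]]; first by exists (x - 1) => //; lra.
exists (Num.max t (if f j < x then f j else t)).
  by rewrite gt_max tx/=; case: ifP => // /negbT; rewrite -leNgt.
apply/andP; split.
  by apply/implyP => /andP[-> fj]; rewrite fj le_max lexx orbT.
apply: sub_all IH => k /implyP IHk; apply/implyP => /IHk/andP[-> fkt].
by rewrite le_max fkt.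
Qed.

Lemma count_iota (p : pred nat) (m n : nat) :
  count p (iota m n) = (\sum_(j < n) p (m + j))%N.
Proof.
elim: n m => [|n IH] m; first by rewrite big_ord0.
rewrite /= IH big_ord_recl addn0; congr addn.
by apply: eq_bigr => j _; rewrite addSnnS.
Qed.

Section Coverage.
Context {R : realType} {d dX dY : measure_display} {Omega : measurableType d}
  {TX : measurableType dX} {TY : measurableType dY}.
Variable Z : int -> Omega -> (TX * TY)%type.
Let S : measurableType _ := (TX * TY)%type.
Variables (ntr ncal : nat) (s : (ntr.+1).-tuple S -> R) (A : set TX) (phi : R).

Definition score (x : ntr.-tuple S * S) : R :=
  s (mktuple (fun j : 'I_ntr.+1 => if (j < ntr)%N then nth x.2 x.1 j else x.2)).

Definition inA (z : S) : bool := `[< A z.1 >].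

Lemma s_hatE w (z : S) : s_hat Z s w z.1 z.2 = score (train Z ntr w, z).
Proof.
rewrite /s_hat /score; congr s; apply: eq_from_tnth => j; rewrite !tnth_mktuple.
case: ifPn => [jn|_]; last by rewrite -surjective_pairing.
by rewrite -[nat_of_ord j]/(val (Ordinal jn)) -tnth_nth tnth_map tnth_mktuple.
Qed.

Let cnt_lt w (x : R) : nat :=
  count (fun i : nat => `[< A (Z (Posz i) w).1 >] &&
    (s_hat Z s w (Z (Posz i) w).1 (Z (Posz i) w).2 < x)) (I_cal ntr ncal).

(** A score is at most the empirical quantile exactly when no smaller [t] reaches the level [phi].
    As only finitely many scores occur, this is a condition on the number of scores strictly
    below. *)
Let in_C_cnt w x y : 0 < phi -> in_C Z ncal s phi A w x y <->
  n_calA Z ntr ncal A w = 0%N \/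
  (cnt_lt w (s_hat Z s w x y))%:R < phi * (n_calA Z ntr ncal A w)%:R.
Proof.
move=> phi0; rewrite /in_C /q_hat; case: (eqVneq (n_calA Z ntr ncal A w) 0%N) => [->|nA0].
  by split => [_|_]; [left|rewrite leey].
have nA : (0 : R) < (n_calA Z ntr ncal A w)%:R by rewrite ltr0n lt0n.
split => [xq|[/eqP|lt_phi]]; last 2 first.
- by rewrite (negbTE nA0).
- apply: le_ereal_inf_tmp => _ [t tphi <-]; rewrite lee_fin leNgt; apply/negP => tx.
  move: tphi; rewrite /= /emp_cdf ler_pdivlMr// leNgt => /negP; apply.
  rewrite (le_lt_trans _ lt_phi)// ler_nat; apply: sub_count => i /= /andP[-> it].
  by rewrite (le_lt_trans it).
right; rewrite ltNge; apply/negP => phi_le.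
have [t tx all_t] := exists_below_above _ _ (I_cal ntr ncal)
  (fun i => `[< A (Z (Posz i) w).1 >])
  (fun i => s_hat Z s w (Z (Posz i) w).1 (Z (Posz i) w).2) (s_hat Z s w x y).
have : (ereal_inf [set t%:E | t in [set t : R | (phi <= emp_cdf Z ncal s A w t)%R]] <= t%:E)%E.
  apply: ereal_inf_lbound; exists t => //=.
  rewrite /emp_cdf ler_pdivlMr// (le_trans phi_le)// ler_nat /cnt_lt.
  elim: (I_cal ntr ncal) all_t => //= i r IH /andP[ti /IH]; apply: leq_add.
  by move: ti; case: (_ && _) => //= ->.
by move=> /(le_trans xq); rewrite lee_fin leNgt tx.
Qed.

Let nA_sum w : (n_calA Z ntr ncal A w)%:R =
  \sum_(j < ncal) (inA (calib Z ntr j w))%:R :> R.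
Proof. by rewrite /n_calA /I_cal count_iota natr_sum. Qed.

Let cnt_sum w (z : S) : (cnt_lt w (score (train Z ntr w, z)))%:R =
  \sum_(j < ncal) (inA (calib Z ntr j w) &&
    (score (train Z ntr w, calib Z ntr j w) < score (train Z ntr w, z)))%:R :> R.
Proof.
rewrite /cnt_lt /I_cal count_iota natr_sum; apply: eq_bigr => j _.
by rewrite s_hatE.
Qed.

Local Notation excessA n kap sc :=
  (excess (train Z ntr) (calib Z ntr) inA sc n kap).

Let exE w z : excessA ncal phi score <%R w z =
  (cnt_lt w (score (train Z ntr w, z)))%:R - phi * (n_calA Z ntr ncal A w)%:R.
Proof. by rewrite cnt_sum nA_sum mulr_sumr -sumrB. Qed.

(** On [A], the weak comparison of negated scores is the complement of the strict one, and each term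
    changes sign since [(1 - x) - (1 - phi) = - (x - phi)]. *)
Let ex_opp w z :
  excessA ncal (1 - phi) (fun x => - score x) <=%R w z = - excessA ncal phi score <%R w z.
Proof.
rewrite /excess -sumrN; apply: eq_bigr => j _; rewrite lerN2 leNgt.
by case: (inA _) => /=; first case: (score _ < score _) => /=; ring.
Qed.

Lemma in_CE w (z : S) : 0 < phi -> in_C Z ncal s phi A w z.1 z.2 <->
  n_calA Z ntr ncal A w = 0%N \/ excessA ncal phi score <%R w z < 0.
Proof. by move=> phi0; rewrite in_C_cnt// s_hatE exE subr_lt0. Qed.

(** Each discarded term is at most [1], because [kap] is nonnegative. *)
Let ex_trunc (n k : nat) (kap : R) (sc : ntr.-tuple S * S -> R) (r : rel R) w z : 0 <= kap ->
  excessA (n + k) kap sc r w z - k%:R <= excessA n kap sc r w z.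
Proof.
move=> kap0; elim: k => [|k IH]; first by rewrite addn0 subr0.
apply: le_trans IH; rewrite addnS /excess big_ord_recr/= -natr1.
set b := (_ && _); set c := inA _.
have b1 : b%:R <= 1 :> R by rewrite lern1 leq_b1.
have c0 : 0 <= kap * c%:R by rewrite mulr_ge0.
by move: (\sum_(_ < n + k) _) b1 c0 => t; lra.
Qed.

Lemma notin_C_excess (n k : nat) w (z : S) : 0 < phi -> ncal = (n + k)%N ->
  ~ in_C Z ncal s phi A w z.1 z.2 -> - k%:R <= excessA n phi score <%R w z.
Proof.
move=> phi0 ncalE; rewrite in_CE// => /not_orP[_ /negP]; rewrite -leNgt => ex0.
have := ex_trunc n k phi score <%R w z (ltW phi0); rewrite -ncalE; lra.
Qed.

(** Acceptance is read as rejection for the negated score at level [1 - phi]. If no calibration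
    point lies in [A], the excess is [0] and the bound still holds. *)
Lemma in_C_excess (n k : nat) w (z : S) : 0 < phi <= 1 -> ncal = (n + k)%N ->
  in_C Z ncal s phi A w z.1 z.2 ->
  - k%:R <= excessA n (1 - phi) (fun x => - score x) <=%R w z.
Proof.
move=> /andP[phi0 phi1] ncalE inC.
have ex0 : excessA ncal phi score <%R w z <= 0.
  have [nA0|/ltW//] := (in_CE _ _ phi0).1 inC.
  rewrite exE nA0 mulr0 subr0 lern0 /cnt_lt -leqn0 -nA0 /n_calA.
  by apply: sub_count => i /= /andP[].
have phi1' : 0 <= 1 - phi by rewrite subr_ge0.
have := ex_trunc n k (1 - phi) (fun x => - score x) <=%R w z phi1'.
rewrite -ncalE ex_opp; lra.
Qed.

End Coverage.

(** An atom at [c] would keep the increment of the distribution function over [[c - e / 2, c]] at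
    least its mass for every [e > 0]. *)
Lemma atomless {R : realType} {d : measure_display} {T : measurableType d}
    (nu : probability T R) (g : T -> R) (c : R) :
  measurable_fun [set: T] g ->
  continuous (fun t => mean nu (fun z => (g z <= t)%R%:R)) ->
  mean nu (fun z => (g z == c)%:R) = 0.
Proof.
move=> mg cF; set F := fun t => _ in cF.
have mle t : measurable_fun [set: T] (fun z => g z <= t).
  by apply: measurable_fun_ler => //; exact: measurable_cst.
have meq : measurable_fun [set: T] (fun z => g z == c).
  by apply: measurable_fun_eqr => //; exact: measurable_cst.
apply/eqP; rewrite eq_le mean_ge0 ?andbT; last by move=> z; exact: ler0n.
rewrite leNgt; apply/negP => x0.
have /cvgrPdist_lt/(_ _ x0) := cF c; rewrite /= => -[e /= e0 /(_ (c - e / 2)) Fe].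
have bc : `|c - (c - e / 2)| < e by rewrite opprB addrCA subrr addr0 gtr0_norm; lra.
move: (Fe bc); apply/negP; rewrite -leNgt (le_trans _ (ler_norm _))// lerBrDr /F -meanD.
- apply: le_mean => [||z]; [|exact/bmf_bool/mle|].
    by apply: bmfD; [exact: bmf_bool|exact/bmf_bool/mle].
  have [->|gc] := eqVneq (g z) c.
    by rewrite lexx (_ : (c <= c - e / 2) = false) ?addr0//; apply/negbTE; rewrite -ltNge; lra.
  rewrite add0r ler_nat; case: (leP (g z) (c - e / 2)) => // gz.
  by rewrite (le_trans gz)//; lra.
- exact: bmf_bool.
- exact/bmf_bool/mle.
Qed.

(** * Coverage bounds after dropping the last calibration points *)

Section CoverageRisk.
Context {R : realType} {d dX dY : measure_display} {Omega : measurableType d}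
  {TX : measurableType dX} {TY : measurableType dY}.
Variables (P : probability Omega R) (Z : int -> Omega -> (TX * TY)%type).
Hypotheses (mZ : process_measurable Z) (statZ : stationary P Z).
Let S : measurableType _ := (TX * TY)%type.
Let nu : probability S R := law P (Z 1) (mZ 1).
Variables (ntr ncal : nat) (s : (ntr.+1).-tuple S -> R) (A : set TX) (phi : R).
Hypotheses (ms : measurable_fun [set: (ntr.+1).-tuple S] s) (mA : measurable A)
  (phi01 : 0 < phi < 1).
Variables (n gap i : nat) (sg : R).
Hypotheses (n0 : (0 < n)%N) (ncalE : ncal = (n + gap.-1)%N)
  (igap : (ntr + n + gap <= i)%N) (sg0 : 0 < sg).

Lemma measurable_inA : measurable_fun [set: S] (inA A : S -> bool).
Proof.
apply: (measurable_fun_bool true); rewrite setTI.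
rewrite (_ : _ @^-1` _ = fst @^-1` A); last first.
  by apply/seteqP; split => z /=; rewrite /inA => /asboolP.
by rewrite -[X in measurable X]setTI; exact: measurable_fst.
Qed.

Lemma measurable_score :
  measurable_fun [set: (ntr.-tuple S * S)%type] (score ntr s).
Proof.
apply: (measurableT_comp ms); apply/measurable_fun_tnthP => j.
rewrite (_ : _ \o _ = fun x : ntr.-tuple S * S => if (j < ntr)%N then nth x.2 x.1 j else x.2).
  by case: (j < ntr)%N; [exact: measurable_nth|exact: measurable_snd].
by apply: funext => x; rewrite /= tnth_mktuple.
Qed.

Let mtr : measurable_fun [set: Omega] (train Z ntr).
Proof. exact: measurable_sample. Qed.

Let mcalib j : measurable_fun [set: Omega] (calib Z ntr j).
Proof. exact: mZ. Qed.

Let ex (m : nat) (kap : R) (sc : ntr.-tuple S * S -> R) (r : rel R) w z : R :=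
  excess (train Z ntr) (calib Z ntr) (inA A) sc m kap r w z.

(** Quantified over all spaces, since the relation is composed with maps on [Omega * S] as well as
    on spaces of tuples. *)
Definition measurable_rel (r : rel R) : Prop :=
  forall (d' : measure_display) (T : measurableType d') (f h : T -> R),
    measurable_fun setT f -> measurable_fun setT h ->
    measurable_fun setT (fun x => r (f x) (h x)).

Let ltr_measurable : measurable_rel <%R.
Proof. by move=> d' T f h; exact: measurable_fun_ltr. Qed.

Let ler_measurable : measurable_rel <=%R.
Proof. by move=> d' T f h; exact: measurable_fun_ler. Qed.

Let mex m kap sc (r : rel R) : measurable_fun setT sc -> measurable_rel r ->
  measurable_fun [set: Omega * S] (fun x => ex m kap sc r x.1 x.2).
Proof.
by move=> msc mr; apply: measurable_excess => //; [exact: measurable_inA|exact: mr].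
Qed.

Let mrisk kap sc r : measurable_fun setT sc -> measurable_rel r ->
  measurable_fun [set: Omega * S]
    (fun x => inA A x.2 && (- gap%:R <= ex n kap sc r x.1 x.2)).
Proof.
move=> msc mr; apply: measurable_and.
  exact: (measurableT_comp measurable_inA measurable_snd).
by apply: measurable_fun_ler; [exact: measurable_cst|exact: mex].
Qed.

Let mdiag : measurable_fun [set: Omega] (fun w => (w, Z i w)).
Proof. by apply: measurable_fun_pair; [exact: measurable_id|exact: mZ]. Qed.

Definition covered (w : Omega) : bool :=
  `[< in_C Z ncal s phi A w (Z i w).1 (Z i w).2 >].

Lemma measurable_covered : measurable_fun [set: Omega] covered.
Proof.
have /andP[phi0 _] := phi01.
rewrite (_ : covered = fun w => (\sum_(j < ncal) (inA A (calib Z ntr j w))%:R <= 0 :> R)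
    || (ex ncal phi (score ntr s) <%R w (Z i w) < 0)).
  apply: measurable_or; last first.
    apply: measurable_fun_ltr; last exact: measurable_cst.
    exact: (measurableT_comp (mex _ _ _ _ measurable_score ltr_measurable) mdiag).
  apply: measurable_fun_ler; last exact: measurable_cst.
  apply: measurable_sum => j; apply: (bmf_bool _ _).1.
  exact: (measurableT_comp measurable_inA (mcalib j)).
apply/funext => w.
apply/asboolP/orP => [/(in_CE Z ntr ncal s A phi w (Z i w) phi0)|] => [[nA|]|[nA|exw]].
- by left; rewrite -natr_sum lern0; apply/eqP; rewrite -[RHS]nA /n_calA /I_cal count_iota.
- by right.
- apply/(in_CE Z ntr ncal s A phi w (Z i w) phi0); left; apply/eqP; move: nA.
  by rewrite -natr_sum lern0 /n_calA /I_cal count_iota.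
- by apply/(in_CE Z ntr ncal s A phi w (Z i w) phi0); right.
Qed.

Let p : R := mean nu (fun z => (inA A z)%:R).
Let err : R := gap%:R / n%:R + sg
  + 2 * (2 * gap%:R / n%:R + 2 * beta_coef P Z gap) / sg + beta_coef P Z gap.

Let gap1 : - gap%:R <= - gap.-1%:R :> R.
Proof. by rewrite lerN2 ler_nat leq_pred. Qed.

Let mAi : measurable_fun [set: Omega] (fun w => inA A (Z i w)).
Proof. exact: (measurableT_comp measurable_inA (mZ i)). Qed.

Lemma miscoverage_le :
  mean P (fun w => (inA A (Z i w) && ~~ covered w)%:R) <= (1 - phi) * p + err.
Proof.
have /andP[phi0 phi1] := phi01.
have mr := mrisk phi _ _ measurable_score ltr_measurable.
apply: (@le_trans _ _ (mean P (fun w => (inA A (Z i w) &&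
    (- gap%:R <= ex n phi (score ntr s) <%R w (Z i w)))%:R))).
  apply: le_mean => [||w].
  - by apply/bmf_bool/measurable_and => //; apply/measurable_neg/measurable_covered.
  - exact/bmf_bool/(measurableT_comp mr mdiag).
  rewrite ler_nat; case: (inA A (Z i w)) => //=.
  case: (boolP (covered w)) => // /asboolP nC.
  have exw : - gap%:R <= ex n phi (score ntr s) <%R w (Z i w) := le_trans gap1
    (notin_C_excess Z ntr ncal s A phi _ _ w (Z i w) phi0 ncalE nC).
  by rewrite exw.
have := test_point_risk P Z mZ statZ ntr n gap (inA A) (score ntr s) phi
  measurable_inA measurable_score <%R i (ltr_measurable _ _) igap.
have kap01 : 0 <= phi <= 1 by rewrite !ltW.
have := process_calibration_risk P Z mZ statZ ntr n gap (inA A) (score ntr s) phi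
  measurable_inA measurable_score sg n0 kap01 sg0.
by rewrite -/nu -/p /err /ex; lra.
Qed.

(** The risk bound is for the strict comparison, whereas coverage leads to the weak one; the absence
    of ties makes their means under [nu] equal. *)
Lemma coverage_le :
  {ae P, forall w, forall c, mean nu (fun z => (score ntr s (train Z ntr w, z) == c)%:R) = 0} ->
  mean P (fun w => (inA A (Z i w) && covered w)%:R) <= phi * p + err.
Proof.
move=> notie; have /andP[phi0 phi1] := phi01.
pose nsc x := - score ntr s x.
have mnsc : measurable_fun setT nsc by exact: measurable_funN measurable_score.
have mle := mrisk (1 - phi) _ _ mnsc ler_measurable.
have mlt := mrisk (1 - phi) _ _ mnsc ltr_measurable.
apply: (@le_trans _ _ (mean P (fun w => (inA A (Z i w) &&
    (- gap%:R <= ex n (1 - phi) nsc <=%R w (Z i w)))%:R))).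
  apply: le_mean => [||w].
  - by apply/bmf_bool/measurable_and => //; exact: measurable_covered.
  - exact/bmf_bool/(measurableT_comp mle mdiag).
  rewrite ler_nat; case: (inA A (Z i w)) => //=.
  case: (boolP (covered w)) => // /asboolP inC.
  have phi01' : 0 < phi <= 1 by rewrite phi0 ltW.
  have exw : - gap%:R <= ex n (1 - phi) nsc <=%R w (Z i w) := le_trans gap1
    (in_C_excess Z ntr ncal s A phi _ _ w (Z i w) phi01' ncalE inC).
  by rewrite exw.
have := test_point_risk P Z mZ statZ ntr n gap (inA A) nsc (1 - phi)
  measurable_inA mnsc <=%R i (ler_measurable _ _) igap.
have kap01 : 0 <= 1 - phi <= 1 by apply/andP; split; lra.
have := process_calibration_risk P Z mZ statZ ntr n gap (inA A) nsc (1 - phi)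
  measurable_inA mnsc sg n0 kap01 sg0.
rewrite -/nu -/p -/(ex _ _ _ _ _ _) /err.
rewrite (eq_ae_mean P (fun w => mean nu (fun z =>
    (inA A z && (- gap%:R <= ex n (1 - phi) nsc <=%R w z))%:R))
  (fun w => mean nu (fun z =>
    (inA A z && (- gap%:R <= ex n (1 - phi) nsc <%R w z))%:R))).
- by rewrite /ex; lra.
- exact: (bmf_mean nu (fun x => (inA A x.2 &&
    (- gap%:R <= ex n (1 - phi) nsc <=%R x.1 x.2))%:R) (bmf_bool _ mle)).
- exact: (bmf_mean nu (fun x => (inA A x.2 &&
    (- gap%:R <= ex n (1 - phi) nsc <%R x.1 x.2))%:R) (bmf_bool _ mlt)).
apply: filterS notie => w notie.
have blew : bmf (fun z => (inA A z && (- gap%:R <= ex n (1 - phi) nsc <=%R w z))%:R : R).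
  by apply: bmf_bool; exact: (measurableT_comp mle (pair1_measurable w)).
have bltw : bmf (fun z => (inA A z && (- gap%:R <= ex n (1 - phi) nsc <%R w z))%:R : R).
  by apply: bmf_bool; exact: (measurableT_comp mlt (pair1_measurable w)).
pose tie (j : nat) z := score ntr s (train Z ntr w, z) ==
  score ntr s (train Z ntr w, calib Z ntr j w).
have btie j : bmf (fun z => (tie j z)%:R : R).
  apply/bmf_bool/measurable_fun_eqr; last exact: measurable_cst.
  exact: (measurableT_comp measurable_score (pair1_measurable _)).
apply: le_anti; apply/andP; split; last first.
  apply: le_mean => // z; rewrite ler_nat; case: (inA A z) => //=.
  case: (boolP (- gap%:R <= ex n _ _ <%R w z)) => //= exz.
  rewrite (le_trans exz)//; apply: ler_sum => j _; rewrite lerD2r ler_nat.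
  by case: (inA _ _) => //=; case: ltP => // /ltW ->.
rewrite -[leRHS]addr0.
(* The sum of the tie indicators has mean zero. Where a tie occurs it is at least [1]; elsewhere the
   two comparisons agree at every calibration point. *)
have <- : mean nu (fun z => \sum_(j < n) (tie j z)%:R) = 0.
  rewrite mean_sum; last by move=> j; exact: btie.
  by rewrite big1// => j _; exact: notie.
rewrite -meanD//; last by apply: bmf_sum => j; exact: btie.
apply: le_mean => [//||z].
  by apply: bmfD => //; apply: bmf_sum => j; exact: btie.
have sum0 : 0 <= \sum_(j < n) (tie j z)%:R :> R by apply: sumr_ge0.
have [[j tj]|notj] := pselect (exists j : 'I_n, tie j z).
  apply: (@le_trans _ _ 1); first by rewrite lern1 leq_b1.
  rewrite (bigD1 j)//= tj addrCA lerDl addr_ge0//.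
  by apply: sumr_ge0.
rewrite (_ : ex n (1 - phi) nsc <=%R w z = ex n (1 - phi) nsc <%R w z).
  by rewrite lerDl.
apply: eq_bigr => j _; rewrite lt_def /nsc eqr_opp.
have -> // : (score ntr s (train Z ntr w, z) ==
  score ntr s (train Z ntr w, calib Z ntr j w)) = false.
by apply/negbTE/negP => tj; apply: notj; exists j.
Qed.

End CoverageRisk.

(** * The error term *)

Lemma ln2_ge_half (R : realType) : 2^-1 <= ln 2 :> R.
Proof.
have h : -1 < 2^-1 - 1 :> R by lra.
have := le_ln1Dx h; rewrite (_ : 1 + (2^-1 - 1) = 2^-1); last by ring.
by rewrite lnV ?posrE//; lra.
Qed.

Lemma le_sqrt_of_sqr (R : realType) (x y : R) : 0 <= x -> x ^+ 2 <= y -> x <= Num.sqrt y.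
Proof.
by move=> x0 xy; rewrite -[x]ger0_norm// -sqrtr_sqr ler_sqrt// (le_trans (sqr_ge0 x)).
Qed.

Lemma eps_cal_term_ge0 (R : realType) (beta : nat -> R) (gamma delta : R)
    (dd ncal a m r : nat) : 0 < gamma -> (0 < r)%N ->
  0 <= eps_cal_term beta gamma delta dd ncal a m r.
Proof.
move=> g0 r0; rewrite /eps_cal_term mulr_ge0 ?invr_ge0 ?(ltW g0)// !addr_ge0//.
by rewrite divr_ge0// mulr_ge0// subr_ge0 ler1n.
Qed.

(** Since [ln 2 >= 1 / 2 >= (2 / 3) ^ 2], the first root is at least [2 / 3] of [1 / sqrt m]; since
    [D <= 1], [ln (16 / D) >= 4 * ln 2 >= 2] and the second is at least [1 / sqrt m]. Finally
    [4 * 2 / 3 + 2 >= 4]. *)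
Lemma eps_cal_term_lb (R : realType) (beta : nat -> R) (gamma delta : R)
    (dd ncal a m r : nat) :
  0 < gamma -> delta < 1 -> (forall k, 0 <= beta k) -> G_cal beta delta ncal a m r ->
  4 / Num.sqrt m%:R <= gamma * eps_cal_term beta gamma delta dd ncal a m r.
Proof.
move=> g0 d1 b0 [a0 m0 r0 _ dpos].
have mR : (1 : R) <= m%:R by rewrite ler1n.
have mR0 : (0 : R) < m%:R by lra.
set x := Num.sqrt m%:R; have x0 : 0 < x by rewrite sqrtr_gt0.
have x2 : x ^+ 2 = m%:R by rewrite sqr_sqrtr// ltW.
have l2 := ln2_ge_half R.
rewrite /eps_cal_term mulrA divff ?gt_eqF// mul1r.
set T1 := Num.sqrt _; set T2 := Num.sqrt _.
have r1 : 0 <= 2 * (r%:R - 1) / ncal%:R :> R.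
  by rewrite divr_ge0// mulr_ge0// subr_ge0 ler1n.
have hT1 : 2 / 3 / x <= T1.
  apply: le_sqrt_of_sqr; first by rewrite divr_ge0// ltW.
  rewrite !expr_div_n x2 ler_pM2r ?invr_gt0//.
  have : ln 2 <= ln (2 * m.+1%:R ^+ dd) :> R.
    by rewrite ler_ln ?posrE ?mulr_gt0 ?exprn_gt0// ler_pMr// exprn_ege1// ler1n.
  by apply: le_trans; lra.
set D := delta - _ - _ in T2 *.
have D0 : 0 < D by rewrite /D; lra.
have D1 : D <= 1.
  have : 0 <= 16 * (m%:R - 1) * beta a by rewrite !mulr_ge0// subr_ge0.
  by have := b0 r; rewrite /D; lra.
have hT2 : x^-1 <= T2.
  apply: le_sqrt_of_sqr; first by rewrite invr_ge0 ltW.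
  rewrite exprVn x2 invfM mulrAC ler_peMl ?invr_ge0 ?(ltW mR0)//.
  have l16 : ln 16 <= ln (16 / D) :> R.
    by rewrite ler_ln ?posrE ?divr_gt0// ler_pdivlMr//; lra.
  have l4 : ln 16 = 4 * ln 2 :> R.
    by rewrite (_ : 16 = 2 ^+ 4) ?lnXn// ?mulr_natl//; ring.
  by lra.
have xi0 : 0 < x^-1 by rewrite invr_gt0.
by lra.
Qed.

(** With [y = 1 / sqrt m], [m > 16] gives [a / n <= 16 / 31 * y ^ 2], [b <= y ^ 2 / 15] and
    [y ^ 2 <= y / 4]; the total is then below [3.5 * y]. *)
Lemma calibration_error_le (R : realType) (a m n : nat) (b : R) :
  16 < m%:R :> R -> (0 < a)%N -> ((2 * m - 1) * a <= n)%N -> 0 <= b ->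
  16 * (m%:R - 1) * b <= 1 ->
  a%:R / n%:R + (Num.sqrt m%:R)^-1 +
    2 * (2 * a%:R / n%:R + 2 * b) / (Num.sqrt m%:R)^-1 + b <= 4 / Num.sqrt m%:R.
Proof.
move=> m16 a0 an b0 bm.
have mR0 : (0 : R) < m%:R by lra.
set x := Num.sqrt m%:R; have x0 : 0 < x by rewrite sqrtr_gt0.
have x2 : x ^+ 2 = m%:R by rewrite sqr_sqrtr// ltW.
have m1 : (0 < m)%N by rewrite -(ltr0n R).
have n0 : (0 < n)%N by apply: leq_trans an; rewrite muln_gt0 a0 andbT; lia.
have nR0 : (0 : R) < n%:R by rewrite ltr0n.
have aR0 : (0 : R) < a%:R by rewrite ltr0n.
set y := x^-1; have y0 : 0 < y by rewrite invr_gt0.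
have xy : x * y = 1 by rewrite divff// gt_eqF.
have x4 : 4 < x.
  rewrite ltNge; apply/negP => x4.
  have : x ^+ 2 <= 4 ^+ 2 by rewrite lerXn2r// ?nnegrE// ltW.
  by rewrite x2; lra.
have y4 : y < 4^-1 by rewrite ltf_pV2 ?posrE.
have y2 : y ^+ 2 * m%:R = 1 by rewrite -x2 -exprMn mulrC xy expr1n.
have G : a%:R / n%:R <= 16 / 31 * y ^+ 2.
  rewrite ler_pdivrMr//.
  have : (2 * m%:R - 1) * a%:R <= n%:R :> R.
    by rewrite -[1]/(1%:R) -natrM -natrB ?muln_gt0// -natrM ler_nat.
  nra.
have B : b <= y ^+ 2 / 15 by nra.
have -> : 2 * (2 * a%:R / n%:R + 2 * b) / y = 4 * (a%:R / n%:R + b) * x.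
  by rewrite /y invrK; ring.
have Gx : a%:R / n%:R * x <= 16 / 31 * y.
  by rewrite (le_trans (ler_wpM2r (ltW x0) G))// expr2 -!mulrA [y * x]mulrC xy mulr1.
have Bx : b * x <= y / 15.
  rewrite (le_trans (ler_wpM2r (ltW x0) B))//.
  have -> : y ^+ 2 / 15 * x = y * (x * y) / 15 by ring.
  by rewrite xy mulr1.
have yy : y ^+ 2 <= y / 4 by rewrite expr2 ler_wpM2l ?ltW.
have -> : 4 * (a%:R / n%:R + b) * x = 4 * (a%:R / n%:R * x) + 4 * (b * x) by ring.
move: (a%:R / n%:R) G Gx => w G Gx.
by move: (w * x) (b * x) Gx Bx => u v Gx Bx; lra.
Qed.

(** Moving [delta] and [y] to the real side first lets the bound pass to the infimum, including the
    value [+oo] when no triple is admissible. *)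
Lemma le_eps_cal (R : realType) (beta : nat -> R) (gamma delta x y : R) (dd ncal : nat) :
  (forall a m r, G_cal beta delta ncal a m r ->
    x <= eps_cal_term beta gamma delta dd ncal a m r + delta + y) ->
  (x%:E <= eps_cal beta gamma delta dd ncal + delta%:E + y%:E)%E.
Proof.
move=> xG; have xeps : ((x - y - delta)%:E <= eps_cal beta gamma delta dd ncal)%E.
  apply: le_ereal_inf_tmp => _ [[[a m] r] /= Gamr <-].
  by rewrite lee_fin; have := xG _ _ _ Gamr; lra.
have -> : x = (x - y - delta) + delta + y by ring.
by rewrite !EFinD leeD2r// leeD2r.
Qed.

(** * Coverage for one admissible triple, and the theorem *)

Lemma conditional_coverage_error {R : realType} {d dX dY : measure_display}
    {Omega : measurableType d} {TX : measurableType dX} {TY : measurableType dY}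
    (P : probability Omega R) (Z : int -> Omega -> (TX * TY)%type)
    (mZ : process_measurable Z) (ntr ncal : nat)
    (s : (ntr.+1).-tuple (TX * TY)%type -> R) (A : set TX) (phi gamma delta : R)
    (dd i a m r : nat) :
  let p := mean (law P (Z 1) (mZ 1)) (fun z => (inA A z)%:R) in
  let term := eps_cal_term (beta_coef P Z) gamma delta dd ncal a m r in
  let hit := mean P (fun w => (inA A (Z i w) && covered Z ntr ncal s A phi i w)%:R) in
  stationary P Z -> measurable_fun [set: (ntr.+1).-tuple (TX * TY)%type] s ->
  measurable A -> 0 < phi < 1 -> 0 < gamma -> gamma < p ->
  G_cal (beta_coef P Z) delta ncal a m r -> delta < 1 -> term < 1 ->
  (ntr + ncal < i)%N ->
  p * (phi - term) <= hit /\
  ({ae P, forall w, forall c,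
     mean (law P (Z 1) (mZ 1)) (fun z => (score ntr s (train Z ntr w, z) == c)%:R) = 0} ->
   hit <= p * (phi + term)).
Proof.
move=> p term hit statZ ms mA phi01 g0 gp Gamr d1 t1 itest.
have [a0 m0 r0 amr dpos] := Gamr.
have beta0 k : 0 <= beta_coef P Z k by exact: beta_coef_ge0.
have lb := eps_cal_term_lb _ _ _ _ dd _ _ _ _ g0 d1 beta0 Gamr.
have t0 : 0 <= term by exact: eps_cal_term_ge0.
have mA' : measurable_fun [set: (TX * TY)%type] (inA A : TX * TY -> bool).
  exact: measurable_inA.
have p1 : p <= 1.
  by apply: mean_le1 => [|z]; [exact: (bmf_bool _ mA')|rewrite lern1 leq_b1].
have sm0 : 0 < Num.sqrt m%:R :> R by rewrite sqrtr_gt0 ltr0n.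
(* From [4 / sqrt m <= gamma * term < 1]. *)
have m16 : 16 < m%:R :> R.
  rewrite -[m%:R]sqr_sqrtr// (_ : 16 = 4 ^+ 2 :> R); last by ring.
  rewrite ltrXn2r// ?nnegrE ?(ltW sm0)//.
  have : 4 / Num.sqrt m%:R < 1 :> R by rewrite (le_lt_trans lb)// -/term; nra.
  by rewrite ltr_pdivrMr// mul1r.
(* Dropping [a - 1] calibration points leaves the last one at time [ntr + ncal + 1 - a], at distance
   at least [a] from [i]. *)
pose n := (ncal + 1 - a)%N.
have aM : (a <= m * a)%N by rewrite leq_pmull.
have nE : n = (2 * m * a + r - a)%N by rewrite /n amr.
have n0 : (0 < n)%N by rewrite nE; lia.
have an : ((2 * m - 1) * a <= n)%N by rewrite nE mulnBl mul1n; lia.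
have ncalE : ncal = (n + a.-1)%N by rewrite /n; lia.
have igap : (ntr + n + a <= i)%N by rewrite /n; lia.
(* The step [1 / sqrt m] balances [sg] against the tails, which are of order [1 / (m * sg)]. *)
have sg0 : 0 < (Num.sqrt m%:R)^-1 :> R by rewrite invr_gt0.
have beta1 : 16 * (m%:R - 1) * beta_coef P Z a <= 1 by have := beta0 r; lra.
have errle := calibration_error_le _ a m n _ m16 a0 an (beta0 a) beta1.
have termle : 4 / Num.sqrt m%:R <= p * term by rewrite (le_trans lb)// ler_wpM2r// ltW.
split.
  have := miscoverage_le P Z mZ statZ ntr ncal s A phi ms mA phi01 n a i _ n0 ncalE igap sg0.
  have mcov := measurable_covered Z mZ ntr ncal s A phi ms mA phi01 i.
  have mAi : measurable_fun [set: Omega] (fun w => inA A (Z i w)).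
    exact: (measurableT_comp mA' (mZ i)).
  (* By stationarity [p] is also the probability of [A] at time [i], so a bound on the miscovered
     mass bounds [hit] from below. *)
  have pE : p = hit + mean P (fun w => (inA A (Z i w) && ~~ covered Z ntr ncal s A phi i w)%:R).
    rewrite /p mean_law; last exact: bmf_bool.
    rewrite (mean_marginal P Z mZ statZ 1 i (fun z => (inA A z)%:R)); last exact: bmf_bool.
    rewrite -meanD; last 2 first.
    - by apply/bmf_bool/measurable_and.
    - by apply/bmf_bool/measurable_and => //; exact: measurable_neg.
    congr (mean P _); apply/funext => w.
    by case: (inA _ _) => /=; first case: (covered Z ntr ncal s A phi i w) => /=; ring.
  by rewrite -/p; lra.
move=> notie.
have := coverage_le P Z mZ statZ ntr ncal s A phi ms mA phi01 n a i _ n0 ncalE igap sg0 notie.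
rewrite -/p -/hit; lra.
Qed.

Theorem theorem3p3
  (R : realType) (d : measure_display) (Omega : measurableType d)
  (P : probability Omega R)
  (dX dY : measure_display) (TX : measurableType dX) (TY : measurableType dY)
  (Z : int -> Omega -> (TX * TY)%type)
  (ntr ncal ntest : nat)
  (s : (ntr.+1).-tuple (TX * TY)%type -> R)
  (W : Omega -> (TX * TY)%type)
  (cA : set (set TX)) (dd : nat) (gamma alpha delta : R) :
  process_measurable Z ->
  stationary P Z ->
  beta_mixing P Z ->
  (0 < ntr)%N -> (0 < ncal)%N -> (0 < ntest)%N ->
  measurable_fun [set: (ntr.+1).-tuple (TX * TY)%type] s ->
  (* W plays (X_star,Y_star): same law as (X_1,Y_1), independent of the sample *)
  measurable_fun [set: Omega] W ->
  (forall B : set (TX * TY)%type, measurable B ->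
     P (W @^-1` B) = P (Z 1 @^-1` B)) ->
  (forall E B, sigma_block Z [set t | 1 <= t <= (ntr + ncal + ntest)%:Z] E ->
     measurable B -> P (E `&` W @^-1` B) = (P E * P (W @^-1` B))%E) ->
  (* the family of sets *)
  (forall A, cA A -> measurable A) ->
  VC_dim cA dd ->
  0 < gamma ->
  (forall A, cA A -> (gamma%:E < P [set w | A (W w).1])%E) ->
  0 < alpha < 1 -> 0 < delta ->
  forall A, cA A ->
  forall i : nat, (ntr + ncal < i <= ntr + ncal + ntest)%N ->
  (let eta := (eps_cal (beta_coef P Z) gamma delta dd ncal + delta%:E
              + (beta_coef P Z (i - ntr))%:E)%E in
  let cov := cond_prob P
      [set w | in_C Z ncal s (1 - alpha) A w (Z (Posz i) w).1 (Z (Posz i) w).2]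
      [set w | A (Z (Posz i) w).1] in
  ((1 - alpha)%:E - eta <= cov%:E)%E /\
  ({ae P, forall w, continuous (fun t : R =>
       fine (P [set w' | s_hat Z s w (W w').1 (W w').2 <= t]))} ->
   (`| cov - (1 - alpha) |%:E <= eta)%E)).
Proof.
move=> mZ statZ _ _ _ _ ms mW lawW _ mcA _ g0 gA /andP[al0 al1] d0 A cAA i /andP[ilo _].
move=> eta cov; have mA := mcA A cAA.
pose phi := 1 - alpha; have phi01 : 0 < phi < 1 by rewrite /phi; apply/andP; split; lra.
pose nu := law P (Z 1) (mZ 1); pose p := mean nu (fun z => (inA A z)%:R).
have mA' : measurable_fun [set: (TX * TY)%type] (inA A : TX * TY -> bool).
  exact: measurable_inA.
have mAi : measurable_fun [set: Omega] (fun w => inA A (Z i w)).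
  exact: (measurableT_comp mA' (mZ i)).
have mcov := measurable_covered Z mZ ntr ncal s A phi ms mA phi01 i.
(* The law of [W] is [nu], so the assumption on [W] yields [gamma < p]. *)
have mean_W (f : TX * TY -> R) : bmf f -> mean nu f = mean P (fun w => f (W w)).
  by move=> bf; rewrite /nu mean_law//; apply: mean_eq_law => // B mB; rewrite lawW.
have pW : p = fine (P [set w | A (W w).1]).
  rewrite /p mean_W; last exact: bmf_bool.
  rewrite mean_bool; last exact: (measurableT_comp mA' mW).
  by congr (fine (P _)); apply/seteqP; split => w /= /asboolP.
have gp : gamma < p.
  have mWA : measurable [set w | A (W w).1].
    have mW1 : measurable_fun [set: Omega] (fun w => (W w).1).
      exact: (measurableT_comp measurable_fst mW).
    by rewrite -[X in measurable X]setTI; exact: (mW1 measurableT A mA).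
  by rewrite pW -lte_fin fineK ?gA// fin_num_measure.
have p0 : 0 < p by exact: lt_trans gp.
pose hit := mean P (fun w => (inA A (Z i w) && covered Z ntr ncal s A phi i w)%:R).
have hit0 : 0 <= hit by apply: mean_ge0 => w; exact: ler0n.
have pE : p = mean P (fun w => (inA A (Z i w))%:R).
  rewrite /p /nu mean_law; last exact: bmf_bool.
  by rewrite (mean_marginal P Z mZ statZ 1 i (fun z => (inA A z)%:R))//; exact: bmf_bool.
have hitp : hit <= p.
  rewrite pE; apply: le_mean => [||w]; [|exact: bmf_bool|].
    by apply/bmf_bool/measurable_and.
  by case: (inA A (Z i w)) => //=; rewrite lern1 leq_b1.
have covE : cov = hit / p.
  rewrite /cov /cond_prob; congr (_ / _).
    rewrite /hit mean_bool; last exact: measurable_and.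
    congr (fine (P _)); apply/seteqP; split => w /=.
      by move=> [inC Aw]; apply/andP; split; exact/asboolP.
    by move=> /andP[/asboolP Aw /asboolP].
  rewrite pE mean_bool//.
  by congr (fine (P _)); apply/seteqP; split => w /= /asboolP.
have cov0 : 0 <= cov by rewrite covE divr_ge0// ltW.
have cov1 : cov <= 1 by rewrite covE ler_pdivrMr// mul1r.
have b0 k : 0 <= beta_coef P Z k by exact: beta_coef_ge0.
(* Differences of numbers in [0, 1] are at most [1], so the claim is immediate if [delta] or the
   term is at least [1]. *)
have bound (x : R) : x <= 1 ->
    (forall a m r, G_cal (beta_coef P Z) delta ncal a m r -> delta < 1 ->
      eps_cal_term (beta_coef P Z) gamma delta dd ncal a m r < 1 ->
      x <= eps_cal_term (beta_coef P Z) gamma delta dd ncal a m r) ->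
    (x%:E <= eta)%E.
  move=> x1 xG; apply: le_eps_cal => a m r Gamr.
  have [_ _ r0 _ _] := Gamr.
  have t0 := eps_cal_term_ge0 _ (beta_coef P Z) gamma delta dd ncal a m r g0 r0.
  have := b0 (i - ntr)%N; set t := eps_cal_term _ _ _ _ _ _ _ _ in t0 *.
  have [d1|d1] := ltP delta 1; last by lra.
  have [t1|t1] := ltP t 1; last by lra.
  by have := xG _ _ _ Gamr d1 t1; rewrite -/t; lra.
have lower : ((phi - cov)%:E <= eta)%E.
  apply: bound => [|a m r Gamr d1 t1]; first by rewrite /phi; lra.
  have [hit_lb _] := conditional_coverage_error P Z mZ ntr ncal s A phi gamma delta
    dd i a m r statZ ms mA phi01 g0 gp Gamr d1 t1 ilo.
  have : phi - eps_cal_term (beta_coef P Z) gamma delta dd ncal a m r <= cov.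
    by rewrite covE ler_pdivlMr// mulrC.
  lra.
split.
  (* When no triple is admissible [eta] is [+oo] and the left side is [-oo]. *)
  case: eta lower {bound} => [e| |]//; last by rewrite addeNy leNye.
  by rewrite -EFinB !lee_fin /phi; lra.
move=> cont.
(* For almost every training sample the score of a draw from [nu] has a continuous distribution
   function, hence no atoms. *)
have notie : {ae P, forall w, forall c,
    mean nu (fun z => (score ntr s (train Z ntr w, z) == c)%:R) = 0}.
  have msc w : measurable_fun [set: (TX * TY)%type] (fun z => score ntr s (train Z ntr w, z)).
    have msc : measurable_fun [set: (ntr.-tuple (TX * TY) * (TX * TY))%type] (score ntr s).
      exact: measurable_score.
    exact: (measurableT_comp msc (pair1_measurable (train Z ntr w))).
  apply: (@filterS _ _ (ae_filter_ringOfSetsType P) _ _ _ cont) => w {}cont c.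
  apply: atomless => //.
  rewrite (_ : (fun t => _) = fun t : R =>
    fine (P [set w' | s_hat Z s w (W w').1 (W w').2 <= t]))//.
  apply/funext => t.
  have mle : measurable_fun [set: (TX * TY)%type]
      (fun z => score ntr s (train Z ntr w, z) <= t).
    by apply: measurable_fun_ler => //; exact: measurable_cst.
  rewrite mean_W; last exact: bmf_bool.
  rewrite mean_bool; last exact: (measurableT_comp mle mW).
  by congr (fine (P _)); apply/seteqP; split => w' /=; rewrite s_hatE.
have upper : ((cov - phi)%:E <= eta)%E.
  apply: bound => [|a m r Gamr d1 t1]; first by rewrite /phi; lra.
  have [_ /(_ notie) hit_ub] := conditional_coverage_error P Z mZ ntr ncal s A phi gamma
    delta dd i a m r statZ ms mA phi01 g0 gp Gamr d1 t1 ilo.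
  have : cov <= phi + eps_cal_term (beta_coef P Z) gamma delta dd ncal a m r.
    by rewrite covE ler_pdivrMr// mulrC.
  lra.
by rewrite -/phi; case: (ger0P (cov - phi)) => _; [exact: upper|rewrite opprB; exact: lower].
Qed.
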